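(* Let the setting, the sets $Q_{DD},\mathcal F_p,\mathcal F_d$, the starting data $z^0,y^0,y_{\tau,0}$, the constants $\xi,\kappa$, the measure $\sigma_f$ and the algorithm PtPCA be as defined in the context. (a) Assume that the primal and dual problems are both strictly feasible, i.e. there exist $x\in\mathbb R^n$ with $Ax\in\operatorname{int}D$ and $y\in\operatorname{int}D_*$ with $A^\top y=-c$. Then PtPCA returns an $\epsilon$-solution in a number of iterations bounded by $$O\left(\sqrt{\vartheta}\,\ln\left(\frac{\vartheta}{\sigma_f\,\epsilon}\right)\right).$$ (b) Assume that there exist $\bar x\in\mathcal F_p$ and $\bar y\in\mathcal F_d$ with $\langle c,\bar x\rangle+\delta_*(\bar y|D)=0$ (zero duality gap). Let $$B:=\frac{\xi\vartheta+\min\{\langle y^0-\bar y,\,z^0-A\bar x\rangle:\ \langle c,\bar x\rangle+\delta_*(\bar y|D)=0,\ \bar x\in\mathcal F_p,\ \bar y\in\mathcal F_d\}}{(\xi-1)\vartheta-\kappa\sqrt{\vartheta}}.$$ Then PtPCA returns an $\epsilon$-solution in a number of iterations bounded by $$O\left(\sqrt{\vartheta}\,\ln\left(\frac{\vartheta B}{\epsilon}\right)\right).$$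
   Context: Setting. $A:\mathbb R^n\to\mathbb R^m$ is linear with kernel $\{0\}$, $c\in\mathbb R^n$, and $D\subset\mathbb R^m$ is a closed convex set with nonempty interior, given as the closure of the domain of a $\vartheta$-self-concordant barrier $\Phi$ ($\vartheta\ge1$). The primal problem is $\inf\{\langle c,x\rangle: Ax\in D\}$. Let $\operatorname{rec}(D)$ be the recession cone of $D$, $D_*:=\{y\in\mathbb R^m:\langle y,h\rangle\le0\ \forall h\in\operatorname{rec}(D)\}$, and $\delta_*(y|D):=\sup\{\langle y,z\rangle: z\in D\}$. The Legendre-Fenchel conjugate $\Phi_*$ of $\Phi$, $\Phi_*(y)=\sup_z\{\langle y,z\rangle-\Phi(z)\}$, has domain $\operatorname{int}D_*$. Put $\mathcal F_p:=\{x\in\mathbb R^n: Ax\in D\}$ and $\mathcal F_d:=\{y\in D_*: A^\top y=-c\}$. For $x\in\mathcal F_p$, $y\in\mathcal F_d$ the duality gap is $\langle c,x\rangle+\delta_*(y|D)$. Starting data. $\xi>1$ is a fixed absolute constant, $z^0\in\operatorname{int}D$ is arbitrary, $y^0:=\Phi'(z^0)$, $y_{\tau,0}:=-\langle y^0,z^0\rangle-\xi\vartheta$. Define $$Q_{DD}:=\{(x,\tau,y): Ax+\tfrac1\tau z^0\in\operatorname{int}D,\ \tau>0,\ A^\top y-A^\top y^0=-(\tau-1)c,\ y\in\operatorname{int}D_*\},$$ and for $(x,\tau,y)\in Q_{DD}$ $$\mu(x,\tau,y):=\frac{\tau}{\xi\vartheta}\Big[-y_{\tau,0}-\tau\langle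 c,x\rangle-\langle y,Ax+\tfrac1\tau z^0\rangle\Big].$$ For a positive definite $B$, $\|v\|_{B}:=\langle Bv,v\rangle^{1/2}$. A point $(x,\tau,y)\in Q_{DD}$ with $\mu:=\mu(x,\tau,y)>0$ is $\kappa$-close to the central path if $\big\|Ax+\tfrac1\tau z^0-\Phi_*'(\tfrac\tau\mu y)\big\|_{[\Phi_*''(\frac\tau\mu y)]^{-1}}\le\kappa$. The constant $\kappa>0$ is fixed with $\xi-1-\kappa>0$. Algorithm. PtPCA (polynomial-time predictor-corrector algorithm) is an algorithm that generates points $(x,\tau,y)\in Q_{DD}$ that are $\kappa$-close to the central path, and there is a constant $\gamma>0$ depending on $\xi$ such that after $N$ iterations the returned point satisfies $\mu(x,\tau,y)\ge\exp(\gamma N/\sqrt\vartheta)$. $\epsilon$-solution. $(x,\tau,y)\in Q_{DD}$ is an $\epsilon$-solution if $\max\{\frac1\tau,\frac{\vartheta\,\mu(x,\tau,y)}{\tau^2}\}\le\epsilon$. Feasibility measure (for part (a)). Under strict primal and dual feasibility let $\bar x(1):=\operatorname{argmin}_x\{\Phi(Ax)+\langle c,x\rangle\}$ (well defined), $\bar y(1):=\Phi'(A\bar x(1))$, $\bar y_\tau(1):=-\xi\vartheta-\langle\bar y(1),A\bar x(1)\rangle$, and $$\sigma_f:=\sup\Big\{\alpha:\ \alpha<1,\ \bar y(1)-\alpha y^0\in D_*,\ \frac{A\bar x(1)-\alpha z^0}{1-\alpha}\in D,\ \delta_*(\bar y(1)-\alpha y^0|D)+\bar y_\tau(1)-\alpha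 y_{\tau,0}\le0\Big\}.$$ The constants hidden in $O(\cdot)$ depend only on $\xi,\kappa$, uniformly for $\epsilon\in(0,1/2]$. *)

(* Defs.v *)
From HB Require Import structures.
From mathcomp Require Import all_boot all_order all_algebra.
From mathcomp Require Import all_classical all_reals all_analysis.

Set Implicit Arguments.
Unset Strict Implicit.
Unset Printing Implicit Defensive.

Import Order.TTheory GRing.Theory Num.Theory.
Import numFieldNormedType.Exports.

Local Open Scope classical_set_scope.
Local Open Scope ring_scope.

Definition dot (R : realType) (k : nat) (u v : 'cV[R]_k) : R :=
  \sum_(i < k) u i ord0 * v i ord0.

Definition grad (R : realType) (k : nat) (f : 'cV[R]_k -> R) (z : 'cV[R]_k) :
    'cV[R]_k :=
  \col_(i < k) 'D_(delta_mx i ord0) f z.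

Definition hess (R : realType) (k : nat) (f : 'cV[R]_k -> R) (z : 'cV[R]_k) :
    'M[R]_k :=
  \matrix_(i < k, j < k) 'D_(delta_mx j ord0) ('D_(delta_mx i ord0) f) z.

(* The norm of [v] induced by [B], of interest when [B] is positive definite. *)
Definition mxnorm (R : realType) (k : nat) (B : 'M[R]_k) (v : 'cV[R]_k) : R :=
  Num.sqrt (dot (B *m v) v).

(* [f] is of class C^k on [U], which is meant to be open: the values of [f]
   outside [U] are then irrelevant. *)
Fixpoint class_C (R : realType) (d k : nat) (U : set 'cV[R]_d)
    (f : 'cV[R]_d -> R) : Prop :=
  (forall z, U z -> {for z, continuous f}) /\
  if k is k'.+1 then
    forall v : 'cV[R]_d,
      (forall z, U z -> derivable f z v) /\ class_C k' U ('D_v f)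
  else True.

(* [Phi] is a [theta]-self-concordant barrier with domain the interior of the
   closed convex set [D]; its values outside that interior are irrelevant. *)
Record self_concordant_barrier (R : realType) (m : nat) (D : set 'cV[R]_m)
    (theta : R) (Phi : 'cV[R]_m -> R) : Prop := SelfConcordantBarrier {
  scb_C3 : class_C 3 D° Phi ;
  scb_convex : convex_function D° Phi ;
  scb_selfconcordant : forall z h : 'cV[R]_m, D° z ->
    `|'D_h ('D_h ('D_h Phi)) z| <= 2 * Num.sqrt ('D_h ('D_h Phi) z) ^+ 3 ;
  scb_boundary : forall z : 'cV[R]_m, (D `\` D°) z ->
    Phi w @[w --> within D° (nbhs z)] --> +oo ;
  scb_parameter : forall z h : 'cV[R]_m, D° z ->
    ('D_h Phi z) ^+ 2 <= theta * 'D_h ('D_h Phi) z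
}.

Definition recession_cone (R : realType) (m : nat) (D : set 'cV[R]_m) :
    set 'cV[R]_m :=
  [set h | forall z t, D z -> 0 <= t -> D (z + t *: h)].

(* D_* *)
Definition rec_polar (R : realType) (m : nat) (D : set 'cV[R]_m) :
    set 'cV[R]_m :=
  [set y | forall h, recession_cone D h -> dot y h <= 0].

(* delta_*( . | D) *)
Definition support_function (R : realType) (m : nat) (D : set 'cV[R]_m)
    (y : 'cV[R]_m) : \bar R :=
  ereal_sup [set (dot y z)%:E | z in D].

(* Phi_*, where Phi is understood to be +oo outside the interior of [D]. *)
Definition conjugate (R : realType) (m : nat) (D : set 'cV[R]_m)
    (Phi : 'cV[R]_m -> R) (y : 'cV[R]_m) : \bar R :=
  ereal_sup [set (dot y z - Phi z)%:E | z in D°].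

(* The data of a problem inf {<c, x> | A x \in D} in domain-driven form, the
   barrier and its parameter, and the starting point z^0. *)
Record dd_problem (R : realType) (n m : nat) := DDProblem {
  ddA : 'M[R]_(m, n) ;
  ddc : 'cV[R]_n ;
  ddD : set 'cV[R]_m ;
  ddPhi : 'cV[R]_m -> R ;
  theta : R ;
  z0 : 'cV[R]_m
}.

Record dd_setting (R : realType) (n m : nat) (P : dd_problem R n m) : Prop :=
  DDSetting {
  dd_ker : forall x : 'cV[R]_n, ddA P *m x = 0 -> x = 0 ;
  dd_closed : closed (ddD P) ;
  dd_convex : convex_set (ddD P) ;
  dd_interior : (ddD P)° !=set0 ;
  dd_theta : 1 <= theta P ;
  dd_barrier : self_concordant_barrier (ddD P) (theta P) (ddPhi P) ;
  dd_z0 : (ddD P)° (z0 P)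
}.

Definition primal_feasible (R : realType) (n m : nat) (P : dd_problem R n m) :
    set 'cV[R]_n :=
  [set x | ddD P (ddA P *m x)].

Definition dual_feasible (R : realType) (n m : nat) (P : dd_problem R n m) :
    set 'cV[R]_m :=
  [set y | rec_polar (ddD P) y /\ (ddA P)^T *m y = - ddc P].

Definition strictly_feasible (R : realType) (n m : nat) (P : dd_problem R n m) :
    Prop :=
  (exists x : 'cV[R]_n, (ddD P)° (ddA P *m x)) /\
  (exists y : 'cV[R]_m, (rec_polar (ddD P))° y /\ (ddA P)^T *m y = - ddc P).

Definition duality_gap (R : realType) (n m : nat) (P : dd_problem R n m)
    (x : 'cV[R]_n) (y : 'cV[R]_m) : \bar R :=
  ((dot (ddc P) x)%:E + support_function (ddD P) y)%E.

Definition zero_gap_pairs (R : realType) (n m : nat) (P : dd_problem R n m) :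
    set ('cV[R]_n * 'cV[R]_m) :=
  [set p | [/\ primal_feasible P p.1, dual_feasible P p.2
             & duality_gap P p.1 p.2 = 0%E]].

Definition y0 (R : realType) (n m : nat) (P : dd_problem R n m) : 'cV[R]_m :=
  grad (ddPhi P) (z0 P).

Definition ytau0 (R : realType) (n m : nat) (P : dd_problem R n m) (xi : R) :
    R :=
  - dot (y0 P) (z0 P) - xi * theta P.

Record dd_point (R : realType) (n m : nat) := DDPoint {
  px : 'cV[R]_n ;
  ptau : R ;
  py : 'cV[R]_m
}.

(* A x + (1 / tau) z^0 *)
Definition shifted (R : realType) (n m : nat) (P : dd_problem R n m)
    (p : dd_point R n m) : 'cV[R]_m :=
  ddA P *m px p + (ptau p)^-1 *: z0 P.

Definition Q_DD (R : realType) (n m : nat) (P : dd_problem R n m) :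
    set (dd_point R n m) :=
  [set p | [/\ (ddD P)° (shifted P p), 0 < ptau p,
               (ddA P)^T *m py p - (ddA P)^T *m y0 P =
                 - ((ptau p - 1) *: ddc P)
             & (rec_polar (ddD P))° (py p)]].

Definition mu (R : realType) (n m : nat) (P : dd_problem R n m) (xi : R)
    (p : dd_point R n m) : R :=
  ptau p / (xi * theta P) *
  (- ytau0 P xi - ptau p * dot (ddc P) (px p) - dot (py p) (shifted P p)).

(* On the interior of D_*, which contains the relevant arguments, Phi_* is
   finite; [fine] only turns it into a real-valued function. *)
Definition close_to_central_path (R : realType) (n m : nat)
    (P : dd_problem R n m) (xi kappa : R) (p : dd_point R n m) : Prop :=
  let Phis := fine \o conjugate (ddD P) (ddPhi P) in
  let y := (ptau p / mu P xi p) *: py p in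
  mxnorm (invmx (hess Phis y)) (shifted P p - grad Phis y) <= kappa.

(* [pt N] is the point returned by PtPCA after [N] iterations; [gamma] is the
   constant of its convergence rate. *)
Definition PtPCA_run (R : realType) (n m : nat) (P : dd_problem R n m)
    (xi kappa gamma : R) (pt : nat -> dd_point R n m) : Prop :=
  forall N : nat,
    [/\ Q_DD P (pt N), 0 < mu P xi (pt N),
        close_to_central_path P xi kappa (pt N)
      & expR (gamma * N%:R / Num.sqrt (theta P)) <= mu P xi (pt N)].

Definition eps_solution (R : realType) (n m : nat) (P : dd_problem R n m)
    (xi eps : R) (p : dd_point R n m) : Prop :=
  Q_DD P p /\
  Num.max (ptau p)^-1 (theta P * mu P xi p / ptau p ^+ 2) <= eps.

(* [get] selects a minimizer of Phi(A x) + <c, x> over {x | A x \in int D},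
   the set where this function is finite. *)
Definition xbar1 (R : realType) (n m : nat) (P : dd_problem R n m) :
    'cV[R]_n :=
  let dom := [set x : 'cV[R]_n | (ddD P)° (ddA P *m x)] in
  let f := fun x : 'cV[R]_n => ddPhi P (ddA P *m x) + dot (ddc P) x in
  get [set x | dom x /\ forall x', dom x' -> f x <= f x'].

Definition ybar1 (R : realType) (n m : nat) (P : dd_problem R n m) :
    'cV[R]_m :=
  grad (ddPhi P) (ddA P *m xbar1 P).

Definition ytaubar1 (R : realType) (n m : nat) (P : dd_problem R n m)
    (xi : R) : R :=
  - (xi * theta P) - dot (ybar1 P) (ddA P *m xbar1 P).

Definition sigma_f (R : realType) (n m : nat) (P : dd_problem R n m) (xi : R) :
    R :=
  sup [set alpha : R |
    [/\ alpha < 1,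
        rec_polar (ddD P) (ybar1 P - alpha *: y0 P),
        ddD P ((1 - alpha)^-1 *: (ddA P *m xbar1 P - alpha *: z0 P))
      & (support_function (ddD P) (ybar1 P - alpha *: y0 P)
         + (ytaubar1 P xi)%:E - (alpha * ytau0 P xi)%:E <= 0)%E]].

(* The minimum over the zero-gap pairs is written as the infimum of a set of
   reals that is bounded below; it is only used when a zero-gap pair exists. *)
Definition B_factor (R : realType) (n m : nat) (P : dd_problem R n m)
    (xi kappa : R) : R :=
  (xi * theta P
   + inf [set dot (y0 P - p.2) (z0 P - ddA P *m p.1) | p in zero_gap_pairs P])
  / ((xi - 1) * theta P - kappa * Num.sqrt (theta P)).

(* Main.v *)
(* Write theta for the parameter of the barrier Phi, and u = A x + z0 / tau for
   an iterate (x, tau, y). Closeness to the central path says that u lies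
   within kappa, in the local norm, of the point w with Phi'(w) = (tau / mu) y;
   the barrier bounds <Phi'(w), z - w> <= theta and
   |<Phi'(w), h>| <= sqrt theta ||h||_w then give
     <y, z - u> <= (mu / tau) (theta + kappa sqrt theta)   for z in D.
   Inserting z = A xb, for a feasible pair (xb, yb) with duality gap at most
   eta, into the definition of mu yields
     (mu / tau) ((xi - 1) theta - kappa sqrt theta)
        <= xi theta + <y0 - yb, z0 - A xb> + tau eta.
   With eta = 0 this is tau >= mu / B. Under strict feasibility, central points
   provide pairs of arbitrarily small gap, and any alpha > 0 admissible in
   sigma_f gives alpha <y0 - yb, z0 - A xb> <= (1 - alpha) (xi theta + eta),
   because A^T (ybar(1) - yb) = 0; hence tau >= const sigma_f mu. Since mu grows
   geometrically, 1 / tau and theta mu / tau^2 then decay geometrically.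

   The point w exists because Phi - <s, .> has compact sublevel sets when s is
   interior to D_*; differentiating the identity Phi'(w(s)) = s shows that
   Phi_*' (s) = w(s) and Phi_*''(s) = Phi''(w(s))^-1. *)
Require Import Defs.
From HB Require Import structures.
From mathcomp Require Import all_boot all_order all_algebra.
From mathcomp Require Import all_classical all_reals all_analysis.
From mathcomp Require Import ring lra.

Set Implicit Arguments.
Unset Strict Implicit.
Unset Printing Implicit Defensive.

Import Order.TTheory GRing.Theory Num.Theory.
Import numFieldNormedType.Exports.

Local Open Scope classical_set_scope.
Local Open Scope ring_scope.

(** * Scalar product and norm *)

Section dot_product.
Context {R : realType} {k : nat}.
Implicit Types (u v w : 'cV[R]_k) (a : R).

Lemma dotE u v : dot u v = (u^T *m v) ord0 ord0.
Proof. by rewrite mxE; apply: eq_bigr => i _; rewrite mxE. Qed.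

Lemma dotC u v : dot u v = dot v u.
Proof. by apply: eq_bigr => i _; rewrite mulrC. Qed.

Lemma dotDr u v w : dot u (v + w) = dot u v + dot u w.
Proof. by rewrite !dotE mulmxDr mxE. Qed.

Lemma dotZr a u v : dot u (a *: v) = a * dot u v.
Proof. by rewrite !dotE -scalemxAr mxE. Qed.

Lemma dotNr u v : dot u (- v) = - dot u v.
Proof. by rewrite -scaleN1r dotZr mulN1r. Qed.

Lemma dotBr u v w : dot u (v - w) = dot u v - dot u w.
Proof. by rewrite dotDr dotNr. Qed.

Lemma dot0r u : dot u 0 = 0.
Proof. by rewrite -(scale0r 0) dotZr mul0r. Qed.

Lemma dotDl u v w : dot (v + w) u = dot v u + dot w u.
Proof. by rewrite !(dotC _ u) dotDr. Qed.

Lemma dotZl a u v : dot (a *: v) u = a * dot v u.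
Proof. by rewrite !(dotC _ u) dotZr. Qed.

Lemma dotNl u v : dot (- v) u = - dot v u.
Proof. by rewrite !(dotC _ u) dotNr. Qed.

Lemma dotBl u v w : dot (v - w) u = dot v u - dot w u.
Proof. by rewrite !(dotC _ u) dotBr. Qed.

Lemma dot0l u : dot 0 u = 0.
Proof. by rewrite dotC dot0r. Qed.

Lemma dot_delta u i : dot u (delta_mx i ord0) = u i ord0.
Proof.
rewrite /dot (bigD1 i)//= mxE !eqxx mulr1 big1 ?addr0// => j ji.
by rewrite mxE (negbTE ji) mulr0.
Qed.

Lemma col_sum_delta v : v = \sum_(i < k) v i ord0 *: delta_mx i ord0.
Proof.
rewrite {1}[v]matrix_sum_delta; apply: eq_bigr => i _.
by rewrite big_ord_recl big_ord0 addr0.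
Qed.

Lemma dot_inj u v : (forall d, dot u d = dot v d) -> u = v.
Proof. by move=> uv; apply/colP => i; rewrite -!dot_delta uv. Qed.

Lemma coord_le_norm m n (A : 'M[R]_(m, n)) i j : `|A i j| <= `|A|.
Proof.
by rewrite [leRHS]/Num.norm /= mx_normrE; apply/bigmax_geP; right; exists (i, j).
Qed.

Lemma norm_le_coord m n (A : 'M[R]_(m, n)) a : 0 <= a ->
  (forall i j, `|A i j| <= a) -> `|A| <= a.
Proof.
move=> a0 Aa; rewrite /Num.norm /= mx_normrE.
by apply/bigmax_leP; split=> // -[].
Qed.

(** The norm of a matrix is the largest absolute value of an entry, so the Cauchy-Schwarz estimate
    takes this form, with the dimension as a factor. *)
Lemma norm_dot u v : `|dot u v| <= k%:R * (`|u| * `|v|).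
Proof.
apply: (le_trans (ler_norm_sum _ _ _)).
apply: (@le_trans _ _ (\sum_(i < k) `|u| * `|v|)); last first.
  by rewrite sumr_const card_ord mulr_natl.
apply: ler_sum => i _; by rewrite normrM ler_pM// coord_le_norm.
Qed.

Lemma sqr_norm_le_dot v : `|v| ^+ 2 <= dot v v.
Proof.
have dge0 : 0 <= dot v v by apply: sumr_ge0 => i _; rewrite -expr2 sqr_ge0.
suff : `|v| <= Num.sqrt (dot v v).
  by move=> /(lerXn2r 2); rewrite !nnegrE sqrtr_ge0 sqr_sqrtr//; apply.
apply: norm_le_coord; first exact: sqrtr_ge0.
move=> i j; rewrite (ord1 j) -(sqrtr_sqr (v i ord0)); apply: ler_wsqrtr.
rewrite /dot (bigD1 i)//= -expr2 lerDl.
by apply: sumr_ge0 => l _; rewrite -expr2 sqr_ge0.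
Qed.

Lemma dot_gt0 v : v != 0 -> 0 < dot v v.
Proof.
move=> v0; apply: lt_le_trans (sqr_norm_le_dot v).
by rewrite exprn_gt0// normr_gt0.
Qed.

Lemma dot_continuous u : continuous (dot u : 'cV[R]_k -> R).
Proof.
rewrite [X in continuous X](_ : _ = \sum_(i < k) (fun v => u i ord0 * v i ord0)).
  apply: (big_ind (fun f : 'cV[R]_k -> R => continuous f)).
  - by move=> v; exact: cst_continuous.
  - by move=> f g cf cg v; exact: (continuousD (cf v) (cg v)).
  - move=> i _ v; apply: (@continuousM _ _ (fun=> u i ord0) (fun v => v i ord0)).
      exact: cst_continuous.
    exact: coord_continuous.
by apply/funext => v; rewrite fct_sumE.
Qed.

End dot_product.

Lemma dot_mulmxl {R : realType} m n (A : 'M[R]_(m, n)) x y :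
  dot y (A *m x) = dot (A^T *m y) x.
Proof. by rewrite !dotE trmx_mul trmxK mulmxA. Qed.

(** * Matrix-vector estimates and quadratic forms *)

Section matrix_analysis.
Context {R : realType} {m : nat}.

Lemma norm_mulmx p q (A : 'M[R]_(p, q)) (x : 'cV[R]_q) :
  `|A *m x| <= q%:R * (`|A| * `|x|).
Proof.
apply: norm_le_coord => [|i j]; first by rewrite mulr_ge0// mulr_ge0.
have -> : (A *m x) i j = dot (row i A)^T x.
  by rewrite (ord1 j) mxE; apply: eq_bigr => k _; rewrite !mxE.
apply: (le_trans (norm_dot _ _)); apply: ler_wpM2l => //; apply: ler_wpM2r => //.
by apply: norm_le_coord => // k l; rewrite !mxE coord_le_norm.
Qed.

Lemma quad_continuous (A : 'M[R]_m) : continuous (fun h : 'cV[R]_m => dot (A *m h) h : R).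
Proof.
rewrite [X in continuous X](_ : _ =
    \sum_(i < m) (fun h : 'cV[R]_m => dot (row i A)^T h * h i ord0)).
  apply: (big_ind (fun f : 'cV[R]_m -> R => continuous f)).
  - by move=> v; exact: cst_continuous.
  - by move=> f g cf cg v; exact: (continuousD (cf v) (cg v)).
  - move=> i _ v.
    apply: (@continuousM _ _ (dot (row i A)^T) (fun h : 'cV[R]_m => h i ord0)).
      exact: dot_continuous.
    exact: coord_continuous.
apply/funext => h; rewrite fct_sumE /dot; apply: eq_bigr => i _.
by rewrite mxE; congr (_ * _); apply: eq_bigr => j _; rewrite !mxE.
Qed.

Lemma hessE (f : 'cV[R]_m -> R) z i j :
  hess f z i j = 'D_(delta_mx j ord0) ('D_(delta_mx i ord0) f) z :> R.
Proof. by rewrite mxE. Qed.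

Lemma nbhs_dist_lt (x e : R) : 0 < e -> nbhs x [set y | `|x - y| < e].
Proof. by move=> e0; have := nbhsx_ballx x e e0; rewrite -ball_normE. Qed.

Lemma coordB p q (A B : 'M[R]_(p, q)) i j : (A - B) i j = A i j - B i j.
Proof. by rewrite !mxE. Qed.

Lemma coordZ p q (a : R) (A : 'M[R]_(p, q)) i j : (a *: A) i j = a * A i j.
Proof. by rewrite mxE. Qed.

End matrix_analysis.

(** * Directional derivatives *)

Section directional_derivative.
Context {R : realType} {k : nat}.
Implicit Types (f : 'cV[R]_k -> R) (U : set 'cV[R]_k) (u v z : 'cV[R]_k).

(** The difference quotients on both sides are the same function of the increment. This reduces
    directional derivatives to one-variable calculus. *)
Lemma is_derive_line f z v (t : R) : derivable f (z + t *: v) v ->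
  is_derive t 1 (fun s => f (z + s *: v)) ('D_v f (z + t *: v)).
Proof.
move=> df.
have E : (fun h : R => h^-1 *: (((fun s => f (z + s *: v)) \o shift t) (h *: 1)
           - f (z + t *: v))) =
         (fun h => h^-1 *: ((f \o shift (z + t *: v)) (h *: v)
           - f (z + t *: v))).
  apply/funext => h /=; congr (_ *: (f _ - _)).
  by rewrite -[h *: 1]/(h * 1) mulr1 scalerDl addrCA.
by split; rewrite /derivable /derive E.
Qed.

(** Chain rule for the restriction of [f] to the line through [z], composed with multiplication by
    [a]; the case [a = 0] is included. *)
Lemma is_deriveZv f z v (a : R) : derivable f z v ->
  is_derive z (a *: v) f (a * 'D_v f z).
Proof.
move=> df; have df' : derivable f (z + 0 *: v) v by rewrite scale0r addr0.
have := is_derive_line df'; rewrite scale0r addr0 => df0.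
have H : is_derive (0 : R) 1 ((fun s => f (z + s *: v)) \o ( *%R a))
    (a * 'D_v f z).
  have da : is_derive (0 : R) 1 ( *%R a) a.
    have := @is_deriveZ R R R idfun a 0 1 1 (is_derive_id _ _).
    by rewrite -[a *: 1]/(a * 1) mulr1.
  have df0' : is_derive (a * 0) 1 (fun s => f (z + s *: v)) ('D_v f z).
    by rewrite mulr0.
  have := @is_derive1_comp R (fun s => f (z + s *: v)) ( *%R a) 0 _ _ df0' da.
  by rewrite mulrC.
have E : (fun h : R => h^-1 *: ((((fun s => f (z + s *: v)) \o ( *%R a)) \o shift 0)
    (h *: 1) - ((fun s => f (z + s *: v)) \o ( *%R a)) 0)) =
   (fun h => h^-1 *: ((f \o shift z) (h *: (a *: v)) - f z)).
  apply/funext => h /=.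
  rewrite mulr0 scale0r !addr0 -[h *: 1]/(h * 1) mulr1 scalerA.
  by rewrite [a * h]mulrC [z + _]addrC.
by case: H => H1 H2; split; rewrite /derivable /derive -E.
Qed.

Lemma deriveZv f z v (a : R) : derivable f z v ->
  'D_(a *: v) f z = a * 'D_v f z.
Proof. by move=> df; have [] := is_deriveZv a df. Qed.

Lemma derivableZv f z v (a : R) : derivable f z v -> derivable f z (a *: v).
Proof. by move=> df; have [] := is_deriveZv a df. Qed.

Lemma MVT_line f z v :
  (forall t : R, 0 <= t -> t <= 1 -> derivable f (z + t *: v) v) ->
  exists2 t : R, 0 < t < 1 & f (z + v) - f z = 'D_v f (z + t *: v).
Proof.
move=> df.
have H (t : R) : t \in `[0, 1]%R ->
    is_derive t 1 (fun s => f (z + s *: v)) ('D_v f (z + t *: v)).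
  rewrite in_itv/= => /andP[t0 t1].
  by apply: is_derive_line; exact: df.
have cf : {within `[0, 1], continuous (fun s : R => f (z + s *: v))}.
  by apply: derivable_within_continuous => t /H[].
have H' (t : R) : t \in `]0, 1[%R ->
    is_derive t 1 (fun s : R => f (z + s *: v)) ('D_v f (z + t *: v)).
  by rewrite in_itv/= => /andP[t0 t1]; apply: H; rewrite in_itv/= !ltW.
have [t t01] := MVT ltr01 H' cf.
rewrite scale1r scale0r addr0 subr0 mulr1 => ->.
by exists t => //; rewrite in_itv in t01.
Qed.

(** The increment along [h (u + v)] is the one along [h u] followed by one along [h v]. By the mean
    value theorem the latter is [h] times a value of ['D_v f] close to [z], and continuity at [z]
    concludes. *)
Lemma deriveDv f U u v z : open U -> U z ->
  (forall w, U w -> derivable f w v) -> {for z, continuous ('D_v f)} ->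
  derivable f z u ->
  'D_(u + v) f z = 'D_u f z + 'D_v f z.
Proof.
move=> oU Uz dv cv du.
pose r (h : R) := h^-1 *: (f (h *: (u + v) + z) - f (h *: u + z)).
suff rv : r h @[h --> 0^'] --> 'D_v f z.
  apply: cvg_lim => //.
  rewrite [X in X @ _ --> _](_ : _ =
      (fun h => h^-1 *: ((f \o shift z) (h *: u) - f z)) \+ r).
    exact: (cvgD du rv).
  by apply/funext => h; rewrite /r /= -scalerDr [in RHS]addrC subrKA.
apply/cvgrPdist_lt => e e0.
have [/= d d0 dU] : exists2 d, 0 < d & ball z d `<=`
    [set w | U w /\ `|'D_v f z - 'D_v f w| < e].
  apply/nbhs_ballP; apply: filterI; first exact: open_nbhs_nbhs.
  by move/cvgrPdist_lt: cv; exact.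
pose M := `|u| + `|v| + 1.
have M0 : 0 < M by rewrite ltr_wpDl// addr_ge0.
near=> h.
have h0 : h != 0 by near: h; exact: nbhs_dnbhs_neq.
have hd : `|h| * M < d.
  rewrite -ltr_pdivlMr//; near: h; apply: dnbhs0_lt; exact: divr_gt0.
have inb (t : R) : 0 <= t -> t <= 1 -> ball z d ((h *: u + z) + t *: (h *: v)).
  move=> t0 t1; rewrite -ball_normE /=.
  rewrite (_ : z - _ = - (h *: u + t *: (h *: v))); last first.
    by rewrite [h *: u + z]addrC -addrA opprD addrA subrr add0r.
  rewrite normrN.
  rewrite (le_lt_trans _ hd)// (le_trans (ler_normD _ _))// !normrZ /M -addrA.
  rewrite [leRHS]mulrDr lerD2l (ger0_norm t0) mulrCA ler_wpM2l//.
  by rewrite (@le_trans _ _ `|v|) ?lerDl// ler_piMl.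
have [|t /andP[t0 t1]] := @MVT_line f (h *: u + z) (h *: v).
  move=> t t0 t1; apply: derivableZv; apply: dv.
  by have [] := dU _ (inb t t0 t1).
have [Uw Dw] := dU _ (inb t (ltW t0) (ltW t1)).
rewrite deriveZv; last exact: dv.
move=> E; rewrite /r (scalerDr h u v) [_ + z]addrAC E.
by rewrite -[h^-1 *: _]/(h^-1 * _) mulKf.
Unshelve. all: by end_near. Qed.

End directional_derivative.

(** * Gradient and Hessian of functions of class C^k *)

Section class_C_theory.
Context {R : realType} {d : nat} (U : set 'cV[R]_d).
Hypothesis oU : open U.
Implicit Types (f : 'cV[R]_d -> R) (u v w z : 'cV[R]_d).

Lemma class_C_continuous k f z : class_C k U f -> U z -> {for z, continuous f}.
Proof. by case: k => [|k] [+ _] Uz; exact. Qed.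

Lemma class_C_derivable k f v z : class_C k.+1 U f -> U z -> derivable f z v.
Proof. by move=> [_ /(_ v)[+ _]] Uz; exact. Qed.

Lemma class_C_derive k f v : class_C k.+1 U f -> class_C k U ('D_v f).
Proof. by move=> [_ /(_ v)[]]. Qed.

Lemma class_CS k f : class_C k.+1 U f -> class_C k U f.
Proof.
elim: k f => [|k IH] f; first by move=> [].
move=> fk; split; first by move=> z; exact: class_C_continuous fk.
move=> v; split; first by move=> z; exact: class_C_derivable fk.
exact: IH (class_C_derive v fk).
Qed.

(** [class_C] speaks of directional derivatives only; their linearity in the direction follows from
    [deriveDv] and [deriveZv] along the expansion of [v] in unit vectors. *)
Lemma derive_grad f v z : class_C 1 U f -> U z -> 'D_v f z = dot (grad f z) v.
Proof.
move=> fC1 Uz; rewrite [in LHS](col_sum_delta v) [in RHS](col_sum_delta v).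
have drv w : derivable f z w by exact: class_C_derivable fC1 Uz.
apply: (big_ind (fun v => 'D_v f z = dot (grad f z) v)).
- by rewrite derive0 dot0r.
- move=> u w Eu Ew; rewrite dotDr -Eu -Ew; apply: (deriveDv oU) => //.
    by move=> x Ux; exact: class_C_derivable fC1 Ux.
  exact: class_C_continuous (class_C_derive w fC1) Uz.
- by move=> i _; rewrite deriveZv// dotZr dot_delta mxE.
Qed.

(** Near [z], ['D_v f] is a fixed combination of partial derivatives. The outer direction [w] meets
    the column index of [hess], the inner direction [v] the row index. *)
Lemma derive2_hess f v w z : class_C 2 U f -> U z ->
  'D_w ('D_v f) z = dot (hess f z *m w) v.
Proof.
move=> fC2 Uz.
have fC1 := class_CS fC2.
have fD1 u : class_C 1 U ('D_u f) by exact: class_C_derive fC2.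
rewrite (@near_eq_derive _ _ _ _
    (\sum_(i < d) v i ord0 \*: 'D_(delta_mx i ord0) f)); last first.
  near=> x; have Ux : U x by near: x; exact: open_nbhs_nbhs.
  rewrite derive_grad// fct_sumE /dot; apply: eq_bigr => i _.
  by rewrite mxE mulrC.
have drv i : derivable ('D_(delta_mx i ord0) f) z w.
  exact: class_C_derivable (fD1 _) Uz.
rewrite derive_sum; last by move=> i; exact: derivableZ.
apply: eq_bigr => i _; rewrite deriveZ// [LHS]mulrC; congr (_ * _).
rewrite derive_grad// /dot mxE; apply: eq_bigr => j _.
by rewrite !mxE.
Unshelve. all: by end_near. Qed.

End class_C_theory.

(** * Closed convex sets *)

Section column_compactness.
Context {R : realType} {k : nat}.

Lemma trmx_continuous m n : continuous (@trmx R m n).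
Proof.
move=> A s /nbhs_ballP[/= e e0 es]; apply/nbhs_ballP; exists e => //= B.
rewrite -ball_normE /= => AB; apply: es.
rewrite -ball_normE /= -(raddfB (@trmx R m n)); apply: le_lt_trans AB.
by apply: norm_le_coord => // i j; rewrite mxE coord_le_norm.
Qed.

(** Transposition is a continuous bijection, so the criterion for row vectors carries over. *)
Lemma bounded_closed_compact_col (A : set 'cV[R]_k) (M : R) :
  (forall v, A v -> `|v| <= M) -> closed A -> compact A.
Proof.
move=> AM cA; pose A' : set 'rV[R]_k := [set u | A u^T].
have -> : A = [set u^T | u in A'].
  apply/seteqP; split => [v Av|_ [u Au <-]//].
  by exists v^T; rewrite /A' /= trmxK.
apply: continuous_compact; first exact/continuous_subspaceT/trmx_continuous.
apply: bounded_closed_compact.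
  exists M; split; first exact: num_real.
  move=> x Mx v /AM vM; apply: le_trans (ltW Mx); apply: le_trans vM.
  rewrite -[v in leLHS]trmxK.
  by apply: norm_le_coord => // i j; rewrite mxE coord_le_norm.
by apply: preimage_closed cA => x _; exact: trmx_continuous.
Qed.

Lemma dist_continuous (z : 'cV[R]_k) : continuous (fun v : 'cV[R]_k => `|v - z|).
Proof.
move=> v s /nbhs_ballP[/= e e0 es]; apply/nbhs_ballP; exists e => //= w.
rewrite -!ball_normE /= => vw; apply: es; rewrite -ball_normE /=.
apply: le_lt_trans vw; rewrite (le_trans (ler_dist_dist _ _))//.
by rewrite opprB addrA subrK.
Qed.

Lemma sphere_compact (z : 'cV[R]_k) (r : R) : compact [set v | `|v - z| = r].
Proof.
apply: (@bounded_closed_compact_col _ (r + `|z|)).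
  by move=> v /= <-; rewrite -{1}[v](subrK z) ler_normD.
have -> : [set v | `|v - z| = r] = (fun v => `|v - z|) @^-1` [set r].
  by [].
by move/continuous_closedP: (@dist_continuous z); apply; exact: closed_eq.
Qed.

End column_compactness.

(** * Segments, recession directions and the polar of the recession cone *)

Section convex_geometry.
Local Open Scope convex_scope.
Context {R : realType} {k : nat}.
Implicit Types (S D : set 'cV[R]_k) (u v w z h : 'cV[R]_k).

(** Convexity in the form of a base point plus a multiple of a difference, which is the form in
    which functions are differentiated along segments. *)
Definition segment_closed S := forall z w (t : R),
  S z -> S w -> 0 <= t <= 1 -> S (z + t *: (w - z)).

Lemma convex_set_segment D : convex_set D -> segment_closed D.
Proof.
move=> cD z w t Dz Dw t01.
have [t0 t1] := andP t01.
pose p : {i01 R} := Itv01 t0 t1.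
have := cD w z p (mem_set Dw) (mem_set Dz); rewrite inE.
suff -> : (w : convex_lmodType _) <| p |> z = z + t *: (w - z) by [].
rewrite /conv /= scalerBr scalerBl scale1r addrCA.
by rewrite addrC -!addrA.
Qed.

(** The homothety with centre [z] and ratio [1 - t] maps a ball around [w] inside [D] onto a ball
    around the new point; [w'] below is the preimage of [u]. *)
Lemma segment_interior D w z (t : R) : segment_closed D ->
  D° w -> D z -> 0 <= t < 1 -> D° (w + t *: (z - w)).
Proof.
move=> cD /nbhs_ballP[/= e e0 De] Dz /andP[t0 t1].
apply/nbhs_ballP; exists ((1 - t) * e) => /=; first by rewrite mulr_gt0// subr_gt0.
move=> u; rewrite -ball_normE /= => ue.
have t1' : 0 < 1 - t by rewrite subr_gt0.
pose w' := w + (1 - t)^-1 *: (u - (w + t *: (z - w))).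
have Dw' : D w'.
  apply: De; rewrite -ball_normE /= /w' opprD addrA subrr sub0r normrN normrZ.
  by rewrite gtr0_norm ?invr_gt0// mulrC ltr_pdivrMr// mulrC distrC.
have -> : u = w' + t *: (z - w').
  rewrite [RHS](_ : _ = (1 - t) *: w' + t *: z); last first.
    by rewrite scalerBr scalerBl scale1r -!addrA [- _ + _]addrC.
  rewrite /w' scalerDr scalerA mulfV ?gt_eqF// scale1r scalerBl scale1r scalerBr.
  by apply/colP => i; rewrite !mxE; ring.
by apply: cD => //; rewrite t0 ltW.
Qed.

Lemma interior_segment_closed D : segment_closed D -> segment_closed D°.
Proof.
move=> cD z w t Dz Dw /andP[t0]; rewrite le_eqVlt => /predU1P[->|t1].
  by rewrite scale1r addrC subrK.
by apply: segment_interior => //; [exact: interior_subset|rewrite t0].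
Qed.

Lemma interior_ball D z : D° z ->
  exists2 e : R, 0 < e & forall w, `|z - w| < e -> D° w.
Proof.
move=> Dz; have : nbhs z D° by apply: open_nbhs_nbhs; split; [exact: open_interior|].
move=> /nbhs_ballP[/= e e0 eD]; exists e => // w zw.
by apply: eD; rewrite -ball_normE.
Qed.

(** Normalised directions from [z] to points of [S] ever farther away have a cluster point [h] on
    the compact unit sphere. Each [z + t h] is then a limit of points on segments of [S]. *)
Lemma unbounded_ray S z : closed S -> segment_closed S -> S z ->
  (forall M : R, exists2 v, S v & M < `|v - z|) ->
  exists2 h, h != 0 & forall t : R, 0 <= t -> S (z + t *: h).
Proof.
move=> clS cS Sz ubS.
have /choice[v_ Pv] : forall n : nat, exists v, S v /\ n%:R < `|v - z|.
  by move=> n; have [v Sv nv] := ubS n%:R; exists v.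
pose r_ n := `|v_ n - z|.
have r_gt0 n : 0 < r_ n by apply: le_lt_trans (Pv n).2.
pose h_ n := (r_ n)^-1 *: (v_ n - z).
have h1 n : `|h_ n - 0| = 1.
  by rewrite subr0 normrZ gtr0_norm ?invr_gt0// mulVf// gt_eqF.
have [|h [/= hn1 hcl]] := @sphere_compact R k 0 1 (h_ @ \oo) _.
  by exists 0%N => // n _; exact: h1.
exists h.
  by apply/eqP => h0; move: hn1; rewrite h0 subrr normr0 => /esym/eqP; rewrite oner_eq0.
move=> t t0; apply: clS => B /nbhs_ballP[/= e e0 Be].
(* Dividing by [t + 1] rather than by [t] covers [t = 0]. *)
have e' : 0 < e / (t + 1) by rewrite divr_gt0// ltr_wpDl.
have [|_ [[n tn <-] hnh]] := hcl (h_ @` [set n | t < n%:R]) (ball h (e / (t + 1)))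
    _ (nbhsx_ballx h _ e').
  exists (Num.truncn t).+1 => // n /= tn; exists n => //=.
  by apply: (lt_le_trans (truncnS_gt t)); rewrite ler_nat.
exists (z + t *: h_ n); split.
  rewrite /h_ scalerA; apply: cS => //; first exact: (Pv n).1.
  rewrite divr_ge0 ?(ltW (r_gt0 n))//= ler_pdivrMr// mul1r.
  by apply/ltW/(lt_trans tn)/(Pv n).2.
apply: Be; rewrite -ball_normE /= opprD addrACA subrr add0r -scalerBr normrZ.
move: hnh; rewrite -ball_normE /= ger0_norm// => hnh.
apply: (@le_lt_trans _ _ (t * (e / (t + 1)))); first by rewrite ler_wpM2l// ltW.
by rewrite mulrA ltr_pdivrMr ?ltr_wpDl// mulrC ltr_pM2l// ltrDl.
Qed.

(** To change the base point to [w], join [w] to the far point [z + s h]. The point at parameter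
    [t / s] differs from [w + t h] by [(t / s) (z - w)], which is small for the large [s] chosen. *)
Lemma ray_recession D z h : closed D -> segment_closed D ->
  (forall t : R, 0 <= t -> D (z + t *: h)) -> recession_cone D h.
Proof.
move=> clD cD Dzh w t Dw t0; apply: clD => B /nbhs_ballP[/= e e0 Be].
pose c := `|z - w|.
have c0 : 0 <= c by exact: normr_ge0.
pose a := t * (c + 1) / e + 1; pose s := a + t.
have a0 : 0 < a by rewrite /a ltr_wpDl// divr_ge0 ?mulr_ge0 ?addr_ge0// ltW.
have s1 : 0 < s by rewrite /s ltr_wpDr.
exists (w + (t / s) *: ((z + s *: h) - w)); split.
  apply: cD => //; first by apply: Dzh; exact: ltW.
  by rewrite divr_ge0 ?(ltW s1)//= ler_pdivrMr// mul1r /s lerDr ltW.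
apply: Be; rewrite -ball_normE /=.
rewrite (_ : _ - _ = - (t / s) *: (z - w)); last first.
  apply/colP => i; rewrite !mxE.
  by field; rewrite gt_eqF.
rewrite normrZ normrN ger0_norm ?divr_ge0// ?ltW// -/c mulrAC ltr_pdivrMr//.
have -> : e * s = t * (c + 1) + e * t + e by rewrite /s /a; field; rewrite gt_eqF.
have : 0 <= e * t by rewrite mulr_ge0// ltW.
nra.
Qed.

(** The point [s] can be moved slightly towards [h] without leaving the polar cone, and this adds a
    positive multiple of [dot h h] to the product. *)
Lemma rec_polar_interior_lt0 D s h : (rec_polar D)° s -> recession_cone D h ->
  h != 0 -> dot s h < 0.
Proof.
move=> /nbhs_ballP[/= e e0 se] Dh h0.
have nh : 0 < `|h| by rewrite normr_gt0.
have e2 : 0 < e / 2 / `|h| by rewrite !divr_gt0.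
have /(_ h Dh) : rec_polar D (s + (e / 2 / `|h|) *: h).
  apply: se; rewrite -ball_normE /= opprD addrA subrr sub0r normrN normrZ.
  by rewrite gtr0_norm// divfK ?gt_eqF// ltr_pdivrMr// ltr_pMr// ltr1n.
rewrite dotDl dotZl => sh; have := mulr_gt0 e2 (dot_gt0 h0); lra.
Qed.

Lemma rec_polar_interiorZ D s (a : R) : 0 < a -> (rec_polar D)° s ->
  (rec_polar D)° (a *: s).
Proof.
move=> a0 /nbhs_ballP[/= e e0 se]; apply/nbhs_ballP; exists (a * e) => /=.
  exact: mulr_gt0.
move=> u; rewrite -ball_normE /= => au h Dh.
have : rec_polar D (a^-1 *: u).
  apply: se; rewrite -ball_normE /= -(ltr_pM2l a0) -{1}(gtr0_norm a0) -normrZ.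
  by rewrite scalerBr scalerA mulfV ?gt_eqF// scale1r.
by move/(_ h Dh); rewrite dotZl pmulr_rle0 ?invr_gt0.
Qed.

(** A recession direction with positive product would make [dot y] unbounded on [D]. *)
Lemma support_function_rec_polar D y (c : R) : D !=set0 ->
  (support_function D y <= c%:E)%E -> rec_polar D y.
Proof.
move=> [z Dz] yc h Dh; rewrite leNgt; apply/negP => yh.
have key (t : R) : 0 <= t -> dot y z + t * dot y h <= c.
  move=> t0; rewrite -dotZr -dotDr -lee_fin; apply: le_trans yc.
  by apply: ereal_sup_ubound; exists (z + t *: h) => //; exact: Dh.
have T0 : 0 <= (`|c - dot y z| + 1) / dot y h.
  by rewrite divr_ge0 ?addr_ge0 ?(ltW yh).
have := key _ T0; rewrite divfK ?gt_eqF//.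
have := ler_norm (c - dot y z); lra.
Qed.

End convex_geometry.

(** * Self-concordant barriers *)

Section barrier_theory.
Context {R : realType} {m : nat}.
Variables (D : set 'cV[R]_m) (theta : R) (Phi : 'cV[R]_m -> R).
Hypotheses (D_closed : closed D) (D_segment : segment_closed D).
Hypotheses (theta_ge1 : 1 <= theta).
Hypothesis Phi_barrier : self_concordant_barrier D theta Phi.
Implicit Types (z w h s : 'cV[R]_m).

Let PhiC3 : class_C 3 D° Phi := scb_C3 Phi_barrier.
Let PhiC2 : class_C 2 D° Phi := class_CS PhiC3.
Let PhiC1 : class_C 1 D° Phi := class_CS PhiC2.
Let dPhiC2 h : class_C 2 D° ('D_h Phi) := class_C_derive h PhiC3.
Let dPhiC1 h : class_C 1 D° ('D_h Phi) := class_C_derive h PhiC2.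
Let theta_gt0 : 0 < theta := lt_le_trans ltr01 theta_ge1.

Lemma barrier_derive z h : D° z -> 'D_h Phi z = dot (grad Phi z) h.
Proof. by move=> Dz; exact: (derive_grad (@open_interior _ D) h PhiC1 Dz). Qed.

Lemma barrier_derive2 z v w : D° z -> 'D_w ('D_v Phi) z = dot (hess Phi z *m w) v.
Proof. by move=> Dz; exact: (derive2_hess (@open_interior _ D) v w PhiC2 Dz). Qed.

(** The parameter inequality bounds [theta] times the second derivative below by a square. *)
Lemma barrier_hess_ge0 z h : D° z -> 0 <= 'D_h ('D_h Phi) z.
Proof.
move=> Dz; rewrite -(pmulr_rge0 _ theta_gt0).
exact: le_trans (sqr_ge0 _) (scb_parameter Phi_barrier h Dz).
Qed.

Lemma interior_line z h (t : R) : D° z -> D° (z + h) -> 0 <= t -> t <= 1 ->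
  D° (z + t *: h).
Proof.
move=> Dz Dzh t0 t1.
rewrite (_ : h = (z + h) - z); last by rewrite addrC addKr.
by apply: (interior_segment_closed D_segment) => //; rewrite t0.
Qed.

Lemma barrier_derive_MVT z h : D° z -> D° (z + h) ->
  exists2 t : R, 0 < t < 1 &
    'D_h Phi (z + h) - 'D_h Phi z = 'D_h ('D_h Phi) (z + t *: h).
Proof.
move=> Dz Dzh; apply: (@MVT_line R m ('D_h Phi) z h) => t t0 t1.
exact: (class_C_derivable (dPhiC1 h) (interior_line Dz Dzh t0 t1)).
Qed.

Lemma barrier_MVT z h : D° z -> D° (z + h) ->
  exists2 t : R, 0 < t < 1 & Phi (z + h) - Phi z = 'D_h Phi (z + t *: h).
Proof.
move=> Dz Dzh; apply: (@MVT_line R m Phi z h) => t t0 t1.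
exact: (class_C_derivable PhiC1 (interior_line Dz Dzh t0 t1)).
Qed.

Lemma barrier_derive_mono z h : D° z -> D° (z + h) ->
  'D_h Phi z <= 'D_h Phi (z + h).
Proof.
move=> Dz Dzh; have [t /andP[t0 t1] E] := barrier_derive_MVT Dz Dzh.
rewrite -subr_ge0 E; apply: barrier_hess_ge0.
by apply: interior_line => //; exact: ltW.
Qed.

Lemma barrier_subgradient z w : D° z -> D° w ->
  Phi z + dot (grad Phi z) (w - z) <= Phi w.
Proof.
move=> Dz Dw; set h := w - z.
have wE : w = z + h by rewrite addrC subrK.
rewrite {}wE in Dw *.
have [t /andP[t0 t1] E] := barrier_MVT Dz Dw.
rewrite addrC -lerBrDr E.
have Dt : D° (z + t *: h) by apply: interior_line => //; exact: ltW.
have := barrier_derive_mono Dz Dt.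
rewrite !barrier_derive// !dotZr ler_pM2l//.
Qed.

(* If psi t = Phi'(z + t h)[h] is positive then - 1 / psi has derivative
   psi' / psi^2 >= 1 / theta, so 1 / psi 0 > 1 / theta. *)
Lemma barrier_bound_interior z h : D° z -> D° (z + h) ->
  dot (grad Phi z) h <= theta.
Proof.
move=> Dz Dzh; rewrite -barrier_derive// leNgt; apply/negP => gt_theta.
pose psi (t : R) := 'D_h Phi (z + t *: h).
have psi_gt0 t : 0 <= t -> t <= 1 -> 0 < psi t.
  move=> t0 t1; apply: (lt_le_trans theta_gt0); apply: (le_trans (ltW gt_theta)).
  have [->|tn0] := eqVneq t 0; first by rewrite /psi scale0r addr0.
  have Dt : D° (z + t *: h) by exact: interior_line.
  have := barrier_derive_mono Dz Dt.
  by rewrite !barrier_derive// !dotZr ler_pM2l ?lt_def ?tn0// /psi barrier_derive.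
pose dpsi (t : R) := 'D_h ('D_h Phi) (z + t *: h).
have dV (t : R) : 0 <= t -> t <= 1 ->
    is_derive t 1 (fun u : R => (psi u)^-1) (- (psi t) ^- 2 *: dpsi t).
  move=> t0 t1; apply: is_deriveV; first by rewrite gt_eqF// psi_gt0.
  apply: is_derive_line; apply: (class_C_derivable (dPhiC1 h)).
  exact: interior_line.
have H' (t : R) : t \in `]0, 1[%R ->
    is_derive t 1 (fun u : R => (psi u)^-1) (- (psi t) ^- 2 *: dpsi t).
  by rewrite in_itv/= => /andP[t0 t1]; apply: dV; exact: ltW.
have cf : {within `[0, 1], continuous (fun u : R => (psi u)^-1)}.
  apply: derivable_within_continuous => t; rewrite in_itv/= => /andP[t0 t1].
  by have [] := dV t t0 t1.
have [t + E] := MVT ltr01 H' cf.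
rewrite in_itv/= => /andP[t0 t1].
have Dt : D° (z + t *: h) by apply: interior_line => //; exact: ltW.
have pt : 0 < psi t by apply: psi_gt0; exact: ltW.
have p0 : theta < psi 0 by rewrite /psi scale0r addr0.
have p1 : 0 < psi 1 by exact: psi_gt0.
have pdt := scb_parameter Phi_barrier h Dt.
move: E; rewrite subr0 mulr1 -[X in _ = X]/(_ * _) mulNr => E.
have : theta^-1 <= psi t ^- 2 * dpsi t.
  by rewrite mulrC ler_pdivlMr ?exprn_gt0// mulrC ler_pdivrMr// mulrC.
have : (psi 0)^-1 < theta^-1 by rewrite ltf_pV2// posrE (lt_trans theta_gt0).
have : 0 < (psi 1)^-1 by rewrite invr_gt0.
move: E; set a := (psi 1)^-1; set b := (psi 0)^-1; set c := _ * dpsi t.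
lra.
Qed.

(** If the product [g] exceeded [theta], moving slightly back from [z] towards [w] would reach an
    interior point whose product, [(theta + g) / 2], still exceeds [theta]. *)
Lemma barrier_bound w z : D° w -> D z -> dot (grad Phi w) (z - w) <= theta.
Proof.
move=> Dw Dz; rewrite leNgt; apply/negP; set g := dot _ _ => gt_theta.
have g0 : 0 < g by exact: lt_trans gt_theta.
pose t := (theta + g) / (2 * g).
have tg : t * g = (theta + g) / 2 by rewrite /t; field; rewrite gt_eqF.
have t01 : 0 <= t < 1.
  rewrite divr_ge0/=; [|exact: addr_ge0 (ltW _) (ltW _)|by rewrite mulr_ge0// ltW].
  by rewrite ltr_pdivrMr ?mulr_gt0// mul1r mulr2n mulrDl !mul1r ltrD2r.
have := barrier_bound_interior Dw (segment_interior D_segment Dw Dz t01).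
by rewrite dotZr -/g tg; lra.
Qed.

Lemma barrier_grad_bound w h : D° w ->
  `|dot (grad Phi w) h| <= Num.sqrt theta * Num.sqrt (dot (hess Phi w *m h) h).
Proof.
move=> Dw; rewrite -sqrtrM ?(ltW theta_gt0)// -sqrtr_sqr ler_wsqrtr//.
by have := scb_parameter Phi_barrier h Dw; rewrite barrier_derive// barrier_derive2.
Qed.

Lemma barrier_hessZ (a : R) h z : D° z ->
  'D_(a *: h) ('D_(a *: h) Phi) z = a ^+ 2 * 'D_h ('D_h Phi) z.
Proof.
move=> Dz; rewrite !(barrier_derive2 _ _ Dz) -scalemxAr dotZl dotZr.
by rewrite mulrA expr2.
Qed.

(* Along the segment g = Phi''[h, h] satisfies g' <= 2 g^(3/2) <= K g, so
   g e^(- K t) does not increase. *)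
Lemma hess_flat z h : D° z -> D° (z + h) ->
  'D_h ('D_h Phi) z = 0 -> 'D_h ('D_h Phi) (z + h) = 0.
Proof.
move=> Dz Dzh flat.
have Dl (t : R) : t \in `[0, 1]%R -> D° (z + t *: h).
  by rewrite in_itv/= => /andP[]; exact: interior_line.
pose g (t : R) := 'D_h ('D_h Phi) (z + t *: h).
pose dg (t : R) := 'D_h ('D_h ('D_h Phi)) (z + t *: h).
have dgP (t : R) : t \in `[0, 1]%R -> is_derive t 1 g (dg t).
  move=> /Dl Dt; apply: is_derive_line.
  exact: class_C_derivable (class_C_derive h (dPhiC2 h)) Dt.
have g_ge0 (t : R) : t \in `[0, 1]%R -> 0 <= g t.
  by move=> /Dl; exact: barrier_hess_ge0.
have cg : {within `[0, 1], continuous g}.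
  by apply: derivable_within_continuous => t /dgP[].
have [c c01 gc] := EVT_max ler01 cg.
(* The maximum [g c] of [g] on the segment bounds one factor [sqrt g], which makes the differential
   inequality linear. *)
pose K := 2 * Num.sqrt (g c).
have dgK (t : R) : t \in `[0, 1]%R -> dg t <= K * g t.
  move=> t01; have gt := g_ge0 t t01.
  have sc : dg t <= 2 * Num.sqrt (g t) ^+ 3.
    exact: le_trans (ler_norm _) (scb_selfconcordant Phi_barrier h (Dl t t01)).
  move: sc gt (gc t t01); rewrite /K.
  move: (g t) (g c) (dg t) => x y d' d'x x0 xy.
  apply: (le_trans d'x); rewrite exprS sqr_sqrtr// mulrA ler_wpM2r//.
  by rewrite ler_wpM2l// ler_wsqrtr.
pose G := g * (fun t : R => expR (- K * t)).
pose dG (t : R) := (dg t - K * g t) * expR (- K * t).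
have dGP (t : R) : t \in `[0, 1]%R -> is_derive t 1 G (dG t).
  move=> t01.
  have dl : is_derive t 1 ( *%R (- K)) (- K).
    have := @is_deriveZ R R R idfun (- K) t 1 1 (is_derive_id _ _).
    by rewrite -[- K *: 1]/(- K * 1) mulr1.
  have de : is_derive t 1 (fun t : R => expR (- K * t)) (expR (- K * t) * - K).
    exact: (@is_derive1_comp R expR ( *%R (- K)) t _ _ (is_derive_expR _) dl).
  have := is_deriveM (dgP t t01) de.
  rewrite -[_ *: _]/(_ * _) -[X in _ + X]/(_ * _).
  by congr (is_derive _ _ _ _); rewrite /dG; ring.
have dGP' (t : R) : t \in `]0, 1[%R -> is_derive t 1 G (dG t).
  rewrite in_itv/= => /andP[t0 t1]; apply: dGP.
  by rewrite in_itv/= !ltW.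
have cG : {within `[0, 1], continuous G}.
  by apply: derivable_within_continuous => t /dGP[].
have [t t01 E] := MVT ltr01 dGP' cG.
have t01' : t \in `[0, 1]%R.
  by move: t01; rewrite !in_itv/= => /andP[t0 t1]; rewrite !ltW.
have G0 : G 0 = 0 by rewrite /G /= -[LHS]/(g 0 * _) /g scale0r addr0 flat mul0r.
have G1 : G 1 <= 0.
  have := E; rewrite G0 subr0 subr0 mulr1 => ->.
  by rewrite /dG mulr_le0_ge0 ?expR_ge0// subr_le0 dgK.
apply/eqP; rewrite eq_le; apply/andP; split; last exact: barrier_hess_ge0.
have g1 : g 1 = 'D_h ('D_h Phi) (z + h) by rewrite /g scale1r.
have G1' : g 1 * expR (- K * 1) <= 0 by exact: G1.
by rewrite -g1 -(pmulr_lle0 _ (expR_gt0 (- K * 1))).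
Qed.

(** Two applications of the mean value theorem lead to the second derivative at [z + a h] with
    [0 < a < 1], where [hess_flat] applies to the direction [a h]. *)
Lemma hess_flat_affine z h : D° z -> D° (z + h) ->
  'D_h ('D_h Phi) z = 0 -> Phi (z + h) = Phi z + 'D_h Phi z.
Proof.
move=> Dz Dzh flat.
have [t /andP[t0 t1] E] := barrier_MVT Dz Dzh.
have Dt : D° (z + t *: h) by apply: interior_line => //; exact: ltW.
rewrite -(subrK (Phi z) (Phi (z + h))) E addrC; congr (_ + _).
have [s /andP[s0 s1]] := barrier_derive_MVT Dz Dt.
rewrite scalerA; set a := s * t => Ea.
have a01 : 0 <= a <= 1 by rewrite mulr_ge0 ?mulr_ile1 ?ltW.
have Da : D° (z + a *: h) by case/andP: a01 => *; exact: interior_line.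
have fa : 'D_(a *: h) ('D_(a *: h) Phi) z = 0 by rewrite barrier_hessZ// flat mulr0.
have := hess_flat Dz Da fa; rewrite (barrier_hessZ a h Da) => /eqP.
have a0 : a != 0 by rewrite mulf_neq0// gt_eqF.
rewrite mulf_eq0 expf_eq0 (negbTE a0)/= => /eqP fa0.
move: Ea; rewrite (barrier_hessZ t h Da) fa0 mulr0.
move/eqP; rewrite subr_eq0 (barrier_derive _ Dt) (barrier_derive _ Dz) !dotZr.
move/eqP; rewrite (barrier_derive _ Dt) (barrier_derive _ Dz).
by apply: mulfI; rewrite gt_eqF.
Qed.

Lemma boundary_blowup p (A : R) : D p -> p \notin (D° : set 'cV[R]_m) ->
  exists2 e : R, 0 < e & forall w, `|p - w| < e -> D° w -> A < Phi w.
Proof.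
move=> Dp; rewrite notin_setE => nDp; have := scb_boundary Phi_barrier (conj Dp nDp).
move=> /cvgryPgt/(_ A)/nbhs_ballP[/= e e0 eA]; exists e => // w pw Dw.
by apply: eA Dw; rewrite -ball_normE.
Qed.

(** If the ray left the interior, let [r] be the supremum of the parameters that stay inside. The
    point at [r] is a boundary point of [D], where [Phi] blows up, yet [Phi] is affine on the part
    before [r] and hence bounded by [A]. *)
Lemma hess_flat_ray z h (t : R) : D° z -> 'D_h ('D_h Phi) z = 0 -> 0 <= t ->
  D° (z + t *: h).
Proof.
move=> Dz flat t0; apply/set_mem; apply: contraT => nDt.
pose E := [set u : R | 0 <= u /\ D° (z + u *: h)].
have E0 : E 0 by split => //; rewrite scale0r addr0.
have shrink (u v : R) : 0 <= u -> u < v -> D° (z + v *: h) -> D° (z + u *: h).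
  move=> u0 uv Dv; have v0 : 0 < v by exact: le_lt_trans uv.
  have -> : u *: h = (u / v) *: (v *: h) by rewrite scalerA divfK ?gt_eqF.
  have uv0 : 0 <= u / v by exact: divr_ge0 u0 (ltW v0).
  have uv1 : u / v <= 1 by rewrite (ler_pdivrMr _ _ v0) mul1r; exact: ltW uv.

  exact: interior_line.
have Et : ubound E t.
  move=> s [s0 Ds]; rewrite leNgt; apply: contra nDt => ts.
  by apply/mem_set; exact: shrink ts Ds.
have supE : has_sup E by split; [exists 0|exists t].
pose r := sup E.
have r0 : 0 <= r by apply: sup_upper_bound.
clear E0.
have Elt (u : R) : 0 <= u -> u < r -> D° (z + u *: h).
  move=> u0 ur; have su : 0 < r - u by rewrite subr_gt0.
  have [v [v0 Dv]] := sup_adherent su supE; rewrite subKr => uv.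
  exact: shrink uv Dv.
have step (e : R) : 0 < e -> exists2 d : R, 0 < d & d * `|h| < e.
  move=> e0; exists (e / (`|h| + 1)); first by rewrite divr_gt0// ltr_wpDl.
  by rewrite mulrAC ltr_pdivrMr ?ltr_wpDl// ltr_pM2l// ltrDl.
have nDr : z + r *: h \notin (D° : set 'cV[R]_m).
  rewrite notin_setE => /interior_ball[e e0 eD].
  have [d d0 de] := step e e0.
  suff : r + d <= r by rewrite gerDl leNgt d0.
  apply: (sup_upper_bound supE); split; first exact: addr_ge0 r0 (ltW d0).
  apply: eD; rewrite opprD addrACA subrr add0r -scalerBl.
  by rewrite opprD addrA subrr sub0r scaleNr normrN normrZ gtr0_norm.
have r_gt0 : 0 < r.
  rewrite lt_def r0 andbT; apply: contra nDr => /eqP ->.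
  by rewrite scale0r addr0; exact: mem_set.
have near_r (e : R) : 0 < e -> exists u : R, [/\ 0 <= u, u < r &
    `|(z + r *: h) - (z + u *: h)| < e].
  move=> /step[d d0 de]; exists (r - Num.min r d); split.
  - by rewrite subr_ge0 ge_min lexx.
  - by rewrite ltrBlDr ltrDl lt_min r_gt0.
  - rewrite opprD addrACA subrr add0r -scalerBl opprB addrC subrK normrZ.
    rewrite ger0_norm ?le_min ?r0 ?ltW//; apply: le_lt_trans de.
    by rewrite ler_wpM2r// ge_min lexx orbT.
have Dr : D (z + r *: h).
  apply: D_closed => B /nbhs_ballP[/= e e0 eB].
  have [u [u0 ur ue]] := near_r e e0.
  exists (z + u *: h); split; first by apply: interior_subset; exact: Elt.
  by apply: eB; rewrite -ball_normE.
pose A := Phi z + r * `|'D_h Phi z|.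
have [e e0 eA] := boundary_blowup A Dr nDr.
have [u [u0 ur ue]] := near_r e e0.
have Du := Elt u u0 ur.
have AP := eA _ ue Du.
suff : Phi (z + u *: h) <= A by rewrite leNgt AP.
have -> : Phi (z + u *: h) = Phi z + u * 'D_h Phi z.
  have fu : 'D_(u *: h) ('D_(u *: h) Phi) z = 0 by rewrite (barrier_hessZ u h Dz) flat mulr0.
  by rewrite (hess_flat_affine Dz Du fu) !(barrier_derive _ Dz) dotZr.
rewrite lerD2l; apply: (le_trans (ler_norm _)).
by rewrite normrM (ger0_norm u0); apply: ler_wpM2r (ltW ur); exact: normr_ge0.
Qed.

(** * Strict convexity, and minimization of the barrier minus a linear form *)

Hypothesis pointed : (rec_polar D)° !=set0.

(* A degenerate direction would span a whole line inside D: Phi is affine along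
   it, hence cannot blow up at a boundary point. Such a line is incompatible
   with D_* having an interior point. *)
Lemma barrier_hess_gt0 z h : D° z -> h != 0 -> 0 < 'D_h ('D_h Phi) z.
Proof.
move=> Dz h0; rewrite lt_def (barrier_hess_ge0 h Dz) andbT; apply/eqP => flat.
have [s Ds] := pointed.
have rec h' : 'D_h' ('D_h' Phi) z = 0 -> recession_cone D h'.
  move=> f'; apply: (ray_recession D_closed D_segment) => t t0.
  exact: interior_subset (hess_flat_ray Dz f' t0).
have flatN : 'D_(- h) ('D_(- h) Phi) z = 0.
  by rewrite -scaleN1r (barrier_hessZ (-1) h Dz) flat mulr0.
have hN0 : - h != 0 by rewrite oppr_eq0.
have := rec_polar_interior_lt0 Ds (rec _ flat) h0.
have := rec_polar_interior_lt0 Ds (rec _ flatN) hN0.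
by rewrite dotNr oppr_lt0 => p n; have := lt_trans p n; rewrite ltxx.
Qed.

Lemma barrier_derive_lt z h : D° z -> D° (z + h) -> h != 0 ->
  'D_h Phi z < 'D_h Phi (z + h).
Proof.
move=> Dz Dzh h0; have [t /andP[t0 t1] E] := barrier_derive_MVT Dz Dzh.
rewrite -subr_gt0 E.
exact: barrier_hess_gt0 (interior_line Dz Dzh (ltW t0) (ltW t1)) h0.
Qed.

(** [barrier_bound] along the whole ray gives the weak inequality; applied at [z + h] and combined
    with strict growth of the derivative along [h], it gives the strict one at [z]. *)
Lemma barrier_grad_recession_lt0 z h : D° z -> recession_cone D h -> h != 0 ->
  dot (grad Phi z) h < 0.
Proof.
move=> Dz Dh h0.
have Dzh (t : R) : 0 <= t -> D° (z + t *: h).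
  (* The point [z + t h] is the midpoint of [z] and [z + 2 t h], hence interior. *)
  move=> t0; have t20 : 0 <= 2 * t by exact: mulr_ge0.
  have Dz2 := Dh z (2 * t) (interior_subset Dz) t20.
  have half : 0 <= (1 / 2 : R) < 1 by rewrite divr_ge0//= ltr_pdivrMr// mul1r ltr1n.
  have -> : t *: h = (1 / 2) *: ((z + (2 * t) *: h) - z).
    by rewrite addrAC subrr add0r scalerA mulrA divfK// mul1r.
  exact: segment_interior D_segment Dz Dz2 half.
have le0 w : (forall t : R, 0 <= t -> D (w + t *: h)) -> D° w ->
    dot (grad Phi w) h <= 0.
  move=> Dw Dw0; rewrite leNgt; apply/negP => g0.
  have t0 : 0 <= (theta + 1) / dot (grad Phi w) h.
    exact: divr_ge0 (addr_ge0 (ltW theta_gt0) ler01) (ltW g0).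
  have := barrier_bound Dw0 (Dw _ t0).
  rewrite addrAC subrr add0r dotZr divfK ?gt_eqF//.
  by rewrite gerDl ler10.
have Dz1 : D° (z + h) by rewrite -[h]scale1r; exact: Dzh ler01.
apply: (@lt_le_trans _ _ (dot (grad Phi (z + h)) h)).
  by rewrite -(barrier_derive _ Dz) -(barrier_derive _ Dz1); exact: barrier_derive_lt.
apply: le0 Dz1 => t t0; apply: interior_subset.
rewrite -addrA -{1}[h]scale1r -scalerDl; apply: Dzh; exact: addr_ge0.
Qed.

(** Its infimum over the interior of [D] is minus the conjugate of [Phi] at [s], and its stationary
    points there solve [grad Phi z = s]. *)
Definition tilted s z := Phi z - dot s z.

Lemma tilted_continuous s z : D° z -> {for z, continuous (tilted s)}.
Proof.
move=> Dz; apply: continuousB; first exact: class_C_continuous PhiC3 Dz.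
exact: dot_continuous.
Qed.

Lemma tilted_convex s z w (t : R) : D° z -> D° w -> 0 <= t <= 1 ->
  tilted s (z + t *: (w - z)) <= (1 - t) * tilted s z + t * tilted s w.
Proof.
move=> Dz Dw t01; set u := z + _.
have Du : D° u by exact: interior_segment_closed D_segment _ _ _ Dz Dw t01.
have [t0 t1] := andP t01.
have zu : z - u = - t *: (w - z) by rewrite opprD addrA subrr sub0r scaleNr.
have wu : w - u = (1 - t) *: (w - z).
  by rewrite opprD addrA scalerBl scale1r.
have := barrier_subgradient Du Dz; rewrite zu dotZr.
have := barrier_subgradient Du Dw; rewrite wu dotZr.
have -> : tilted s u = Phi u - (1 - t) * dot s z - t * dot s w.
  by rewrite /tilted /u dotDr dotZr dotBr; ring.
rewrite /tilted; move: (dot (grad Phi u) _) (dot s z) (dot s w) => g a b.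
move: (Phi u) (Phi w) (Phi z) t0 t1 => pu pw pz; nra.
Qed.

(* An unbounded sublevel set would contain a ray z1 + t h; along it Phi has
   slope at least - theta / t while - <s, .> has the positive slope - <s, h>. *)
Lemma barrier_min (L : set 'cV[R]_m) s z1 : closed L -> segment_closed L ->
  (rec_polar D)° s -> D° z1 -> L z1 ->
  exists2 w, D° w /\ L w &
    forall z, D° z -> L z -> tilted s w <= tilted s z.
Proof.
move=> clL sL Ds Dz1 Lz1.
pose S := [set z | [/\ D° z, L z & tilted s z <= tilted s z1]].
have Sz1 : S z1 by split.
have SD : S `<=` D by move=> z [Dz _ _]; exact: interior_subset.
have segS : segment_closed S.
  move=> z w t [Dz Lz Fz] [Dw Lw Fw] t01; split.
  - exact: interior_segment_closed D_segment _ _ _ Dz Dw t01.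
  - exact: sL.
  - apply: le_trans (tilted_convex s Dz Dw t01) _.
    move: t01 Fz Fw; move: (tilted s z) (tilted s w) (tilted s z1) => a b c.
    by move=> /andP[t0 t1] ac bc; nra.
have clS : closed S.
  move=> p clp.
  have Dp : D p.
    by apply: D_closed => B Bp; have [z [/SD Dz Bz]] := clp B Bp; exists z.
  have Lp : L p.
    by apply: clL => B Bp; have [z [[_ Lz _] Bz]] := clp B Bp; exists z.
  have [Dop|nDp] := boolP (p \in (D° : set 'cV[R]_m)).
    have Dop' : D° p by exact: set_mem.
    split => //; rewrite leNgt; apply/negP => lt1.
    have [z [[_ _ +]]] := clp _ (@tilted_continuous s p Dop' _ (lt_nbhsr lt1)).
    by rewrite leNgt => /negP zn zp; apply: zn.
  (* A limit point on the boundary is impossible: [Phi] blows up there, while membership in [S]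
     bounds [Phi] near it. *)
  exfalso.
  have [e e0 eA] := boundary_blowup (tilted s z1 + dot s p + 1) Dp nDp.
  have cds := @dot_continuous R m s p.
  have ltd : dot s p < dot s p + 1 by rewrite ltrDl.
  have nb : nbhs p (ball p e `&` [set z | dot s z < dot s p + 1]).
    apply: filterI; first exact: nbhsx_ballx.
    exact: (cds _ (lt_nbhsl ltd)).
  have [z [[Dz _ Fz] [+ /= sz]]] := clp _ nb.
  rewrite -ball_normE /= => /eA /(_ Dz).
  move: Fz sz; rewrite {1}/tilted.
  by move: (dot s z) (dot s p) (Phi z) (tilted s z1) => a b c d; lra.
have bS : exists M : R, forall z, S z -> `|z| <= M.
  apply: contrapT => nb.
  have [M|h h0 Sh] := unbounded_ray clS segS Sz1.
    apply: contrapT => nM; apply: nb; exists (M + `|z1|) => z Sz.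
    rewrite -[z](subrK z1); apply: (le_trans (ler_normD _ _)); rewrite lerD2r.
    by rewrite leNgt; apply/negP => Mz; apply: nM; exists z.
  clear nb.
  have Dh : recession_cone D h.
    by apply: (ray_recession D_closed D_segment) => t t0; exact: SD (Sh t t0).
  have sh := rec_polar_interior_lt0 Ds Dh h0.
  pose c := - dot s h; have c0 : 0 < c by rewrite oppr_gt0.
  (* With this [t0] the slope of [Phi] at [u] along [h] is at least [- theta / t0 = - c / 2], so the
     tilted function grows at rate at least [c / 2] beyond [u]. *)
  pose t0 := 2 * theta / c.
  have t00 : 0 < t0 by rewrite divr_gt0// mulr_gt0.
  have [Dt0 _ _] := Sh t0 (ltW t00).
  set u := z1 + t0 *: h in Dt0.
  have gu : - (c / 2) <= dot (grad Phi u) h.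
    have zu : z1 - u = - t0 *: h by rewrite /u opprD addrA subrr sub0r scaleNr.
    have := barrier_bound Dt0 (interior_subset Dz1).
    rewrite zu dotZr mulNr.
    have t0c : t0 * c = 2 * theta by rewrite /t0 divfK// gt_eqF.
    have aux (a b g th : R) : a * b = 2 * th -> - (a * g) <= th ->
      a * - (b / 2) <= a * g by lra.
    by move=> bg; rewrite -(ler_pM2l t00); exact: aux t0c bg.
  (* [K] equals [tilted s z1 - tilted s u]. A further stretch of length [r] adds at least
     [r c / 2 = |K| + 1], which leaves the sublevel set. *)
  pose K := tilted s z1 - Phi u + dot s z1 - t0 * c.
  pose r := 2 * (`|K| + 1) / c.
  have r0 : 0 <= r by rewrite divr_ge0 ?(ltW c0)// mulr_ge0// addr_ge0.
  have rc : r * c = 2 * (`|K| + 1) by rewrite /r divfK// gt_eqF.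
  have [Dt _ Ft] := Sh (t0 + r) (addr_ge0 (ltW t00) r0).
  have vu : z1 + (t0 + r) *: h - u = r *: h.
    by apply/colP => i; rewrite !mxE; ring.
  have := barrier_subgradient Dt0 Dt; rewrite vu dotZr.
  move: Ft; rewrite {1}/tilted dotDr dotZr.
  have -> : dot s h = - c by rewrite opprK.
  have aux (g sz pu F1 pt k a b d : R) : pt - (sz + (a + b) * - d) <= F1 ->
      pu + b * g <= pt -> F1 - pu + sz - a * d <= k -> b * d = 2 * (k + 1) ->
      - (d / 2) <= g -> 0 <= b -> 0 <= k -> False.
    nra.
  move=> E1 E2; exact: aux E1 E2 (ler_norm K) rc gu r0 (normr_ge0 K).
have [M bM] := bS.
have cS := bounded_closed_compact_col bM clS.
have cF : {within S, continuous (tilted s)}.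
  apply: continuous_in_subspaceT => z /set_mem[Dz _ _].
  exact: tilted_continuous.
have [w /set_mem[Dw Lw Fw] wmin] := compact_EVT_min (ex_intro _ _ Sz1) cS cF.
exists w => // z Dz Lz.
have [Fz|/ltW Fz] := leP (tilted s z) (tilted s z1); last exact: le_trans Fw Fz.
by apply: wmin; apply/mem_set.
Qed.

(** Minimality along a single line is all that is asked, so that the lemma serves minima over the
    interior of [D] and minima over the range of a matrix alike. *)
Lemma tilted_stationary s w d : D° w ->
  (forall t : R, D° (w + t *: d) -> tilted s w <= tilted s (w + t *: d)) ->
  dot (grad Phi w) d = dot s d.
Proof.
move=> Dw wmin; have [e e0 eD] := interior_ball Dw.
pose a := e / (`|d| + 1).
have a0 : 0 < a by rewrite divr_gt0// ltr_wpDl.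
have Dt (t : R) : t \in `](- a), a[%R -> D° (w + t *: d).
  rewrite in_itv/= -ltr_norml => ta; apply: eD.
  rewrite opprD addrA subrr sub0r normrN normrZ.
  have : `|t| * (`|d| + 1) < e by rewrite -ltr_pdivlMr// ltr_wpDl.
  by apply: le_lt_trans; rewrite ler_wpM2l// lerDl.
pose f := (fun t : R => Phi (w + t *: d)) - (fun t : R => dot s w + t * dot s d).
have df (t : R) : t \in `](- a), a[%R ->
    is_derive t 1 f ('D_d Phi (w + t *: d) - dot s d).
  move=> ta; apply: is_deriveB.
    exact: is_derive_line (class_C_derivable PhiC3 (Dt t ta)).
  rewrite -[X in is_derive _ _ _ X]add0r.
  apply: is_deriveD.
  have := @is_deriveZ R R R idfun (dot s d) t 1 1 (is_derive_id _ _).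
  rewrite -[dot s d *: 1]/(dot s d * 1) mulr1.
  by congr is_derive; apply/funext => u; rewrite /= mulrC.
have aa : - a <= a by rewrite ge0_cp// ltW.
have in0 : (0 : R) \in `](- a), a[%R by rewrite in_itv/= oppr_lt0 a0.
have [|t ta|_] := @derive1_at_min R f (- a) a 0 aa _ in0.
- by move=> t /df[].
- have := wmin t (Dt t ta).
  rewrite /tilted /f dotDr dotZr.
  rewrite -[(_ - _ : _ -> _) 0]/(Phi (w + 0 *: d) - (dot s w + 0 * dot s d)).
  by rewrite scale0r addr0 mul0r addr0.
have [_ ->] := df 0 in0; rewrite scale0r addr0 (barrier_derive _ Dw) => /eqP.
by rewrite subr_eq0 => /eqP.
Qed.

(** * Local estimates for the Hessian and the gradient *)

Lemma hess_near w (e : R) : D° w -> 0 < e ->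
  exists2 r : R, 0 < r & forall z, `|w - z| < r ->
    D° z /\ `|hess Phi z - hess Phi w| <= e.
Proof.
move=> Dw e0.
have near_ij : \forall z \near w, forall ij : 'I_m * 'I_m,
    `|hess Phi w ij.1 ij.2 - hess Phi z ij.1 ij.2| < e.
  apply: (@filter_forall _ _
    (fun ij z => `|hess Phi w ij.1 ij.2 - hess Phi z ij.1 ij.2| < e)
    (nbhs w) (nbhs_filter w)) => -[i j] /=.
  have cij := class_C_continuous (class_C_derive (delta_mx j ord0)
    (dPhiC1 (delta_mx i ord0))) Dw.
  apply/nbhs_ballP.
  have Eij : 'D_(delta_mx j ord0) ('D_(delta_mx i ord0) Phi) = fun z => hess Phi z i j.
    by apply/funext => z; rewrite hessE.
  rewrite Eij in cij.
  have /nbhs_ballP[/= r r0 rP] := cij _ (nbhs_dist_lt _ e0).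
  by exists r; [exact: r0|exact: rP].
have [d d0 dD] := interior_ball Dw.
move/nbhs_ballP : near_ij => [/= r r0 rH].
exists (Num.min r d); first by rewrite lt_min r0.
move=> z; rewrite lt_min => /andP[zr zd]; split; first exact: dD.
apply: norm_le_coord => [|i j]; first exact: ltW.
have := rH z; rewrite -ball_normE /= => /(_ zr (i, j))/ltW /=.
by rewrite distrC coordB.
Qed.

(** The quadratic form at [w] attains a positive minimum [c] on the unit sphere. The Hessian varies
    so little near [w] that at least [c / 2] remains. *)
Lemma hess_coercive w : D° w -> exists l r : R, [/\ 0 < l, 0 < r &
  forall z h, `|w - z| < r -> D° z /\ l * `|h| ^+ 2 <= 'D_h ('D_h Phi) z].
Proof.
move=> Dw.
have [c c0 cP] : exists2 c : R, 0 < c &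
    forall h, c * `|h| ^+ 2 <= dot (hess Phi w *m h) h.
  pose S := [set h : 'cV[R]_m | `|h - 0| = 1].
  have scaled h : h != 0 -> S (`|h|^-1 *: h).
    move=> h0; rewrite /S /= subr0 normrZ ger0_norm ?invr_ge0// mulVf//.
    by rewrite normr_eq0.
  (* The unit sphere is empty in dimension 0. *)
  have [S0|/set0P Sn0] := eqVneq S set0.
    exists 1 => // h; have [->|h0] := eqVneq h 0.
      by rewrite normr0 dot0r expr0n /= mulr0.
    by exfalso; have := scaled h h0; rewrite S0.
  have cq : {within S, continuous (fun h => dot (hess Phi w *m h) h : R)}.
    exact/continuous_subspaceT/quad_continuous.
  have [u /set_mem Su umin] := compact_EVT_min Sn0 (@sphere_compact R m 0 1) cq.
  have u0 : u != 0.
    apply/eqP => u0; move: Su; rewrite /S /= u0 subr0 normr0 => /esym/eqP.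
    by rewrite oner_eq0.
  exists (dot (hess Phi w *m u) u).
    by rewrite -(barrier_derive2 _ _ Dw); exact: barrier_hess_gt0.
  move=> h; have [->|h0] := eqVneq h 0.
    by rewrite normr0 dot0r expr0n /= mulr0.
  have := umin _ (mem_set (scaled h h0)).
  rewrite -scalemxAr dotZl dotZr mulrA -expr2 exprVn mulrC.
  by rewrite ler_pdivlMr// exprn_gt0// normr_gt0.
(* The estimates for the matrix product and for the scalar product contribute a factor [m] each. *)
pose e := c / (2 * (m%:R ^+ 2 + 1)).
have M0 : 0 < 2 * (m%:R ^+ 2 + 1) :> R by rewrite mulr_gt0// ltr_wpDl// sqr_ge0.
have e0 : 0 < e by rewrite divr_gt0.
have [r r0 rP] := hess_near Dw e0.
exists (c / 2), r; split => //; first by rewrite divr_gt0.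
move=> z h zr; have [Dz Hz] := rP z zr; split => //.
rewrite (barrier_derive2 _ _ Dz).
have -> : dot (hess Phi z *m h) h =
    dot (hess Phi w *m h) h + dot ((hess Phi z - hess Phi w) *m h) h.
  by rewrite -dotDl -mulmxDl addrC subrK.
have b1 : `|dot ((hess Phi z - hess Phi w) *m h) h| <= m%:R ^+ 2 * e * `|h| ^+ 2.
  apply: (le_trans (norm_dot _ _)).
  have : `|(hess Phi z - hess Phi w) *m h| <= m%:R * (e * `|h|).
    apply: (le_trans (norm_mulmx _ _)); apply: ler_wpM2l => //.
    exact: ler_wpM2r.
  move=> /(ler_wpM2r (normr_ge0 h))/(ler_wpM2l (ler0n R m)).
  by move/le_trans; apply; rewrite le_eqVlt; apply/orP; left; apply/eqP; ring.
have b2 : m%:R ^+ 2 * e <= c / 2.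
  rewrite /e mulrA ler_pdivrMr//.
  have -> : c / 2 * (2 * (m%:R ^+ 2 + 1)) = c * (m%:R ^+ 2 + 1) by field.
  by rewrite mulrC ler_wpM2l ?ltW// ltrDl.
have b3 := ler_wpM2r (sqr_ge0 `|h|) b2.
have := cP h; move: b1; rewrite ler_norml => /andP[b1 _].
move: b1 b3; move: (dot _ _) (dot _ _) (m%:R ^+ 2 * e * _) => x y t.
move: (`|h| ^+ 2) => n; lra.
Qed.

(** Up to distance [r / 2] from [w] the Hessian bound applies. Farther out, monotonicity along the
    segment only preserves the gain made at that distance, hence the minimum. *)
Lemma grad_coercive w : D° w -> exists l r : R, [/\ 0 < l, 0 < r &
  forall z, D° z -> l * Num.min r `|z - w| * `|z - w| <=
    dot (grad Phi z - grad Phi w) (z - w)].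
Proof.
move=> Dw; have [l [r [l0 r0 lP]]] := hess_coercive Dw.
exists l, (r / 2); split => //; first by rewrite divr_gt0.
move=> z Dz; set d := z - w.
have [d0|d0] := eqVneq d 0; first by rewrite d0 normr0 mulr0 dot0r.
have nd : 0 < `|d| by rewrite normr_gt0.
set q := Num.min _ _.
have q0 : 0 < q by rewrite lt_min nd divr_gt0.
have qr : q < r.
  by rewrite (@le_lt_trans _ _ (r / 2)) ?ge_min ?lexx// ltr_pdivrMr// ltr_pMr// ltr1n.
pose t := q / `|d|.
have t0 : 0 < t by exact: divr_gt0.
have td : t * `|d| = q by rewrite divfK// gt_eqF.
have t1 : t <= 1 by rewrite ler_pdivrMr// mul1r ge_min lexx orbT.
have zE : z = w + d by rewrite addrC subrK.
have Dz' : D° (w + d) by rewrite -zE.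
have Du := interior_line Dw Dz' (ltW t0) t1; set u := w + t *: d in Du.
have mono : dot (grad Phi u) d <= dot (grad Phi z) d.
  move: t1; rewrite le_eqVlt => /predU1P[t1|t1].
    by rewrite /u t1 scale1r -zE.
  have t1' : 0 < 1 - t by rewrite subr_gt0.
  have zu : z = u + (1 - t) *: d.
    by rewrite zE /u; apply/colP => i; rewrite !mxE; ring.
  rewrite zu in Dz; have := barrier_derive_mono Du Dz.
  by rewrite (barrier_derive _ Du) (barrier_derive _ Dz) !dotZr ler_pM2l// -zu.
have [v /andP[v0 v1]] := barrier_derive_MVT Dw Du.
rewrite (barrier_derive _ Du) (barrier_derive _ Dw) !dotZr => E.
have [_] : D° (w + v *: (t *: d)) /\
    l * `|t *: d| ^+ 2 <= 'D_(t *: d) ('D_(t *: d) Phi) (w + v *: (t *: d)).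
  apply: lP; rewrite opprD addrA subrr sub0r normrN 2!normrZ (gtr0_norm v0).
  rewrite (gtr0_norm t0) td; apply: le_lt_trans qr.
  by rewrite ler_piMl// ltW.
rewrite -E -mulrBr normrZ (gtr0_norm t0) td expr2 -{1}td.
have -> : l * (t * `|d| * q) = t * (l * q * `|d|) by ring.
rewrite (ler_pM2l t0) => /le_trans; apply.
by rewrite dotBl lerD2r.
Qed.

(** Mean value theorem for each component of the gradient, together with continuity of the
    Hessian. *)
Lemma grad_expansion w (e : R) : D° w -> 0 < e ->
  exists2 r : R, 0 < r & forall d, `|d| < r ->
    `|grad Phi (w + d) - grad Phi w - hess Phi w *m d| <= e * `|d|.
Proof.
move=> Dw e0.
have e'0 : 0 < e / (m%:R + 1) by rewrite divr_gt0// ltr_wpDl.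
have [r r0 rP] := hess_near Dw e'0.
exists r => // d dr.
have wd (t : R) : 0 <= t -> t <= 1 -> `|w - (w + t *: d)| < r.
  move=> t0 t1; rewrite opprD addrA subrr sub0r normrN normrZ ger0_norm//.
  by apply: le_lt_trans dr; rewrite ler_piMl.
apply: norm_le_coord => [|i j]; first by rewrite mulr_ge0// ltW.
have df (t : R) : 0 <= t -> t <= 1 ->
    derivable ('D_(delta_mx i ord0) Phi) (w + t *: d) d.
  move=> t0 t1; have [Dt _] := rP _ (wd t t0 t1).
  exact: class_C_derivable (dPhiC1 _) Dt.
have [t /andP[t0 t1] E] := MVT_line df.
have [Dt Ht] := rP _ (wd t (ltW t0) (ltW t1)).
rewrite (ord1 j).
have -> : (grad Phi (w + d) - grad Phi w - hess Phi w *m d) i ord0 =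
   'D_d ('D_(delta_mx i ord0) Phi) (w + t *: d) - (hess Phi w *m d) i ord0.
  by rewrite -E !mxE.
rewrite (barrier_derive2 _ _ Dt) dot_delta.
have -> : forall A B : 'M[R]_m, (A *m d) i ord0 - (B *m d) i ord0 = ((A - B) *m d) i ord0.
  by move=> A B; rewrite mulmxBl !mxE.
apply: (le_trans (coord_le_norm _ _ _)); apply: (le_trans (norm_mulmx _ _)).
rewrite mulrA; apply: ler_wpM2r => //.
apply: (@le_trans _ _ (m%:R * (e / (m%:R + 1)))); first exact: ler_wpM2l.
by rewrite mulrA ler_pdivrMr ?ltr_wpDl// mulrC ler_wpM2l ?ltW// ltrDl.
Qed.

Lemma hess_unit w : D° w -> hess Phi w \in unitmx.
Proof.
move=> Dw; rewrite -unitmx_tr -row_free_unit; apply: inj_row_free => v v0.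
apply/eqP; apply: contraT => vn0.
have vTn0 : v^T != 0.
  by apply: contra vn0 => /eqP vT0; rewrite -[v]trmxK vT0 trmx0.
have := barrier_hess_gt0 Dw vTn0; rewrite (barrier_derive2 _ _ Dw).
by rewrite -[_ *m _]trmxK trmx_mul trmxK v0 trmx0 dot0l ltxx.
Qed.

(** * The inverse of the gradient map and the conjugate barrier *)

Hypothesis D_interior : D° !=set0.

Lemma gradient_inverse : exists W : 'cV[R]_m -> 'cV[R]_m,
  forall s, (rec_polar D)° s -> D° (W s) /\ grad Phi (W s) = s.
Proof.
have [z1 Dz1] := D_interior.
suff /choice[W WP] : forall s, exists w, (rec_polar D)° s ->
    D° w /\ grad Phi w = s by exists W.
(* Outside the interior of the polar cone, [z1] is a default value. *)
move=> s; have [Ds|nDs] := pselect ((rec_polar D)° s); last by exists z1.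
have LT : segment_closed (setT : set 'cV[R]_m) by [].
have [w [Dw _] wmin] := barrier_min closedT LT Ds Dz1 I.
exists w => _; split => //; apply: dot_inj => d.
by apply: (tilted_stationary Dw) => t Dt; exact: wmin.
Qed.

Lemma conjugate_gradient w : D° w ->
  conjugate D Phi (grad Phi w) = (dot (grad Phi w) w - Phi w)%:E.
Proof.
move=> Dw; apply/eqP; rewrite eq_le; apply/andP; split.
  apply: ub_ereal_sup => _ [z Dz <-]; rewrite lee_fin.
  have := barrier_subgradient Dw Dz; rewrite dotBr.
  by move: (dot _ z) (dot _ w) (Phi z) (Phi w) => a b c d; lra.
by apply: ereal_sup_ubound; exists w.
Qed.

Section gradient_inverse_map.
Variable W : 'cV[R]_m -> 'cV[R]_m.
Hypothesis WP : forall s, (rec_polar D)° s -> D° (W s) /\ grad Phi (W s) = s.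
Let Phis : 'cV[R]_m -> R := fine \o conjugate D Phi.

(** [grad_coercive] at [W s] bounds [Num.min r |d|] by [K |s' - s|]. For [s'] close to [s] this is
    below [r], so the minimum is [|d|]. *)
Lemma gradient_inverse_lipschitz s : (rec_polar D)° s ->
  exists K e : R, [/\ 0 < K, 0 < e & forall s', `|s - s'| < e ->
    (rec_polar D)° s' /\ `|W s' - W s| <= K * `|s' - s|].
Proof.
move=> Ds; have [Dw gw] := WP Ds.
have [l [r [l0 r0 lP]]] := grad_coercive Dw.
have [e e0 eD] := interior_ball Ds.
pose K := (m%:R + 1) / l.
have K0 : 0 < K by rewrite divr_gt0// ltr_wpDl.
exists K, (Num.min e (r / K)); split => //; first by rewrite lt_min e0 divr_gt0.
move=> s'; rewrite lt_min => /andP[/eD Ds' sr]; split => //.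
have [Dw' gw'] := WP Ds'; set d := W s' - W s.
have [->|d0] := eqVneq d 0; first by rewrite normr0 mulr_ge0// ltW.
have nd : 0 < `|d| by rewrite normr_gt0.
have := lP _ Dw'; rewrite gw' gw -/d => H.
have {H}: l * Num.min r `|d| <= (m%:R + 1) * `|s' - s|.
  rewrite -(ler_pM2r nd); apply: (le_trans H).
  apply: (le_trans (ler_norm _)); apply: (le_trans (norm_dot _ _)).
  rewrite mulrA; apply: ler_wpM2r => //; apply: ler_wpM2r => //.
  by rewrite lerDl.
rewrite mulrC -ler_pdivlMr// mulrAC -/K minEle.
case: ifP => [_ rK|_ //].
move: sr; rewrite ltr_pdivlMr// mulrC distrC => /lt_le_trans /(_ rK).
by rewrite ltxx.
Qed.

Lemma conjugateE s : (rec_polar D)° s -> Phis s = dot s (W s) - Phi (W s).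
Proof.
move=> Ds; have [Dw gw] := WP Ds.
by rewrite /Phis /= -[in LHS]gw conjugate_gradient// gw.
Qed.

(** The subgradient inequalities at [w] and [w'] squeeze the error of the first-order expansion
    between 0 and [dot (h *: v) (w' - w)], which is of order [h^2] by the Lipschitz bound. *)
Lemma is_derive_conjugate s v : (rec_polar D)° s ->
  is_derive s v Phis (dot v (W s)).
Proof.
move=> Ds; have [K [e [K0 e0 Klip]]] := gradient_inverse_lipschitz Ds.
pose q (h : R) := h^-1 *: ((Phis \o shift s) (h *: v) - Phis s).
suff qv : q h @[h --> 0^'] --> (dot v (W s) : R).
  by split; [apply/cvg_ex; exists (dot v (W s)); exact: qv|exact: cvg_lim qv].
pose C := m%:R * (`|v| * (K * `|v|)) + 1.
have C0 : 0 < C by rewrite ltr_wpDl// !mulr_ge0// ltW.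
apply/cvgrPdist_lt => eps eps0; near=> h.
have h0 : h != 0 by near: h; exact: nbhs_dnbhs_neq.
have nh : 0 < `|h| by rewrite normr_gt0.
have hC : `|h| * C < eps.
  by rewrite -ltr_pdivlMr//; near: h; apply: dnbhs0_lt; exact: divr_gt0.
have hv : `|h| * (`|v| + 1) < e.
  rewrite -ltr_pdivlMr ?ltr_wpDl//; near: h; apply: dnbhs0_lt.
  by rewrite divr_gt0// ltr_wpDl.
have [Ds' dW] : (rec_polar D)° (h *: v + s) /\
    `|W (h *: v + s) - W s| <= K * `|h *: v + s - s|.
  apply: Klip; rewrite opprD addrCA subrr addr0 normrN normrZ.
  by apply: le_lt_trans hv; rewrite ler_wpM2l// lerDl.
rewrite addrK in dW.
have [Dw gw] := WP Ds; have [Dw' gw'] := WP Ds'.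
set w' := W (h *: v + s) in dW Dw' gw' *; set w := W s in dW Dw gw *.
have lo := barrier_subgradient Dw' Dw.
have hi := barrier_subgradient Dw Dw'.
rewrite gw' in lo; rewrite gw in hi.
have bd : `|dot (h *: v) (w' - w)| <= `|h| * (`|h| * (C - 1)).
  apply: (le_trans (norm_dot _ _)); rewrite addrK.
  have := ler_wpM2l (normr_ge0 (h *: v)) dW.
  move=> /(ler_wpM2l (ler0n R m))/le_trans; apply.
  by rewrite normrZ le_eqVlt; apply/orP; left; apply/eqP; ring.
rewrite /q /= (conjugateE Ds') (conjugateE Ds) -/w' -/w.
rewrite -[_ *: _]/(h^-1 * _).
have -> : dot v w - h^-1 * (dot (h *: v + s) w' - Phi w' - (dot s w - Phi w)) =
    h^-1 * (dot (h *: v) w - (dot (h *: v + s) w' - Phi w' - (dot s w - Phi w))).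
  by rewrite [in RHS]dotZl [in RHS]mulrBr mulKf.
rewrite normrM normfV mulrC ltr_pdivrMr//.
have : `|dot (h *: v) w - (dot (h *: v + s) w' - Phi w' - (dot s w - Phi w))| <=
    `|dot (h *: v) (w' - w)|.
  move: lo hi; rewrite !dotDl !dotBr.
  move: (dot (h *: v) w) (dot (h *: v) w') (dot s w) (dot s w') (Phi w) (Phi w').
  move=> a b x y p p' lo hi.
  have ab : 0 <= b - a by lra.
  by rewrite (ger0_norm ab) ler_norml; apply/andP; split; lra.
move=> /le_trans /(_ bd) /le_lt_trans; apply.
rewrite mulrC ltr_pM2r//; apply: le_lt_trans hC.
by rewrite ler_wpM2l// gerBl.
Unshelve. all: by end_near. Qed.

Lemma grad_conjugate s : (rec_polar D)° s -> grad Phis s = W s.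
Proof.
move=> Ds; apply/colP => i; rewrite mxE.
have [_ ->] := is_derive_conjugate (delta_mx i ord0) Ds.
by rewrite dotC dot_delta.
Qed.

(** Expanding [grad Phi (W (s + h v)) = s + h v] at [W s] gives [H d = h v + o(d)] for the increment
    [d] of [W]. Since [d] is of order [h], applying the inverse of [H] gives the derivative. *)
Lemma derive_gradient_inverse s v i : (rec_polar D)° s ->
  'D_v (fun s => W s i ord0) s = (invmx (hess Phi (W s)) *m v) i ord0.
Proof.
move=> Ds; have [K [e [K0 e0 Klip]]] := gradient_inverse_lipschitz Ds.
have [Dw gw] := WP Ds.
set H := hess Phi (W s).
have uH : H \in unitmx by exact: hess_unit.
apply: cvg_lim => //; apply/cvgrPdist_lt => eps eps0.
(* [M] exceeds the product of all factors that multiply the expansion error. *)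
pose M := m%:R * `|invmx H| * K * (`|v| + 1) + 1.
have M0 : 0 < M.
  by rewrite ltr_wpDl// !mulr_ge0 ?addr_ge0// ltW.
have [r r0 rP] := grad_expansion Dw (divr_gt0 eps0 M0).
near=> h.
have h0 : h != 0 by near: h; exact: nbhs_dnbhs_neq.
have nh : 0 < `|h| by rewrite normr_gt0.
have v1 : 0 < `|v| + 1 by rewrite ltr_wpDl.
have hv : `|h| * (`|v| + 1) < Num.min e (r / K).
  rewrite -ltr_pdivlMr//; near: h; apply: dnbhs0_lt.
  by rewrite divr_gt0// lt_min e0 divr_gt0.
have hv' : `|h *: v| < Num.min e (r / K).
  by rewrite normrZ; apply: le_lt_trans hv; rewrite ler_wpM2l// lerDl.
have [Ds' dW] : (rec_polar D)° (h *: v + s) /\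
    `|W (h *: v + s) - W s| <= K * `|h *: v + s - s|.
  apply: Klip; rewrite opprD addrCA subrr addr0 normrN.
  by apply: lt_le_trans hv' _; rewrite ge_min lexx.
rewrite addrK in dW; have [Dw' gw'] := WP Ds'.
set d := W (h *: v + s) - W s in dW.
have wd : W (h *: v + s) = W s + d by rewrite [RHS]addrC subrK.
have dr : `|d| < r.
  apply: (le_lt_trans dW); rewrite mulrC -ltr_pdivlMr//.
  by apply: (lt_le_trans hv'); rewrite ge_min lexx orbT.
have := rP d dr; rewrite -wd gw' gw addrK -/H => Hd.
have E : h *: (invmx H *m v) - d = invmx H *m (h *: v - H *m d).
  by rewrite mulmxBr -scalemxAr mulKmx.
have nE : `|h *: (invmx H *m v) - d| < `|h| * eps.
  rewrite E; apply: (le_lt_trans (norm_mulmx _ _)).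
  have b1 : `|h *: v - H *m d| <= eps / M * (K * (`|h| * (`|v| + 1))).
    apply: (le_trans Hd); apply: ler_wpM2l; first exact: ltW (divr_gt0 eps0 M0).
    apply: (le_trans dW); apply: ler_wpM2l; first exact: ltW.
    by rewrite normrZ ler_wpM2l// lerDl.
  have := ler_wpM2l (ler0n R m) (ler_wpM2l (normr_ge0 (invmx H)) b1).
  move=> /le_lt_trans; apply.
  have -> : m%:R * (`|invmx H| * (eps / M * (K * (`|h| * (`|v| + 1))))) =
      `|h| * eps * ((M - 1) / M) by rewrite addrK; ring.
  rewrite gtr_pMr ?mulr_gt0// ltr_pdivrMr// mul1r.
  by rewrite ltrBlDr ltrDl.
rewrite /= -[_ *: (_ - _)]/(h^-1 * _).
have -> : (invmx H *m v) i ord0 - h^-1 * (W (h *: v + s) i ord0 - W s i ord0) =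
    h^-1 * (h *: (invmx H *m v) - d) i ord0.
  by rewrite coordB coordZ [RHS]mulrBr mulKf// -coordB.
rewrite normrM normfV mulrC ltr_pdivrMr//.
by apply: (le_lt_trans (coord_le_norm _ _ _)); rewrite mulrC in nE *.
Unshelve. all: by end_near. Qed.

Lemma hess_conjugate s : (rec_polar D)° s ->
  hess Phis s = invmx (hess Phi (W s)).
Proof.
move=> Ds; apply/matrixP => i j; rewrite hessE.
have near_s : \near s, 'D_(delta_mx i ord0) Phis s = W s i ord0.
  have [e e0 eD] := interior_ball Ds.
  apply/nbhs_ballP; exists e; first exact: e0.
  move=> s'; rewrite -ball_normE /= => /eD Ds'.
  have [_ ->] := is_derive_conjugate (delta_mx i ord0) Ds'.
  by rewrite dotC dot_delta.
rewrite (near_eq_derive _ near_s) (derive_gradient_inverse _ _ Ds).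
rewrite mxE (bigD1 j)//= mxE !eqxx mulr1 big1 ?addr0// => k kj.
by rewrite mxE (negbTE kj) mulr0.
Qed.

End gradient_inverse_map.

(** Translates [close_to_central_path] into the local norm of [Phi] at the point [w] with gradient
    [s]. *)
Lemma conjugate_duality s : (rec_polar D)° s -> exists w,
  let Phis := fine \o conjugate D Phi in
  [/\ D° w, grad Phi w = s, grad Phis s = w &
      invmx (hess Phis s) = hess Phi w].
Proof.
move=> Ds; have [W WP] := gradient_inverse.
have [Dw gw] := WP s Ds; exists (W s); split => //.
  exact: grad_conjugate.
by rewrite (hess_conjugate WP Ds) invmxK.
Qed.

(** * Stability of the barrier bound under perturbation of the gradient *)

(** The part of [D] where the product is at least -1 is bounded, because an unbounded one would
    contain a recession direction, on which the gradient is negative. Scaling towards [w] turns this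
    into linear decay. *)
Lemma barrier_decay w : D° w -> exists2 c : R, 0 < c &
  forall z, D z -> dot (grad Phi w) (z - w) <= theta + 1 - c * `|z - w|.
Proof.
move=> Dw; set g := grad Phi w.
pose S := [set z | D z /\ -1 <= dot g (z - w)].
have Sw : S w by split; [exact: interior_subset|rewrite subrr dot0r oppr_le0].
have segS : segment_closed S.
  move=> z v t [Dz gz] [Dv gv] t01; split; first exact: D_segment.
  have -> : z + t *: (v - z) - w = (1 - t) *: (z - w) + t *: (v - w).
    by apply/colP => i; rewrite !mxE; ring.
  rewrite dotDr !dotZr; move: t01 gz gv => /andP[].
  by move: (dot g (z - w)) (dot g (v - w)) => a b; nra.
have clS : closed S.
  move=> p clp; split.
    by apply: D_closed => B Bp; have [z [[Dz _] Bz]] := clp B Bp; exists z.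
  rewrite leNgt; apply/negP; rewrite dotBr ltrBlDr => lt1.
  have [z [[_ +] /= zp]] := clp _ (@dot_continuous R m g p _ (lt_nbhsl lt1)).
  by rewrite dotBr lerBrDr leNgt zp.
have [r r0 rP] : exists2 r : R, 0 < r & forall z, S z -> `|z - w| <= r.
  apply: contrapT => nb.
  have [M|h h0 Sh] := unbounded_ray clS segS Sw.
    apply: contrapT => nM; apply: nb; exists (`|M| + 1); first by rewrite ltr_wpDl.
    move=> z Sz; rewrite leNgt; apply/negP => Mz; apply: nM; exists z => //.
    by apply: le_lt_trans Mz; rewrite (le_trans (ler_norm M))// lerDl.
  clear nb.
  have Dh : recession_cone D h.
    by apply: (ray_recession D_closed D_segment) => t t0; exact: (Sh t t0).1.
  have gh : dot g h < 0 by exact: barrier_grad_recession_lt0 Dw Dh h0.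
  have t0 : 0 <= 2 / - dot g h by rewrite divr_ge0// oppr_ge0 ltW.
  have [_] := Sh _ t0.
  rewrite addrAC subrr add0r dotZr invrN mulrN mulNr divfK ?lt_eqF//.
  by rewrite lerN2 leNgt ltr1n.
exists (r + 1)^-1; first by rewrite invr_gt0 ltr_wpDl// ltW.
move=> z Dz; have R0 : 0 < r + 1 by rewrite ltr_wpDl// ltW.
have [zr|zr] := leP `|z - w| (r + 1).
  apply: (le_trans (barrier_bound Dw Dz)); rewrite -addrA lerDl subr_ge0.
  by rewrite mulrC ler_pdivrMr// mul1r.
have nz : 0 < `|z - w| by exact: lt_trans zr.
(* This [t] places the point at distance [r + 1] from [w], outside [S], so its product is below
   -1. *)
pose t := (r + 1) / `|z - w|.
have t0 : 0 < t by exact: divr_gt0.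
have t01 : 0 <= t <= 1 by rewrite (ltW t0) ler_pdivrMr// mul1r ltW.
have Dt := D_segment (interior_subset Dw) Dz t01.
have tz : w + t *: (z - w) - w = t *: (z - w) by rewrite addrAC subrr add0r.
have gt1 : dot g (t *: (z - w)) < -1.
  rewrite ltNge; apply/negP => ge1.
  have : `|w + t *: (z - w) - w| <= r by apply: rP; split => //; rewrite tz.
  rewrite tz normrZ (gtr0_norm t0) divfK ?gt_eqF//.
  by apply/negP; rewrite -ltNge ltrDl.
move: gt1; rewrite dotZr; set a := dot _ _ => gt1.
have -> : (r + 1)^-1 * `|z - w| = t^-1 by rewrite /t invf_div mulrC.
have : a < - t^-1.
  by rewrite -(ltr_pM2l t0) mulrN mulfV ?gt_eqF.
by have := theta_gt0; lra.
Qed.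

(** Average [barrier_bound] and [barrier_decay] with weights [1 - l] and [l]. The choice [l c = a K]
    lets the decay absorb the perturbation, at a cost [l <= eta]. *)
Lemma barrier_support_perturb w y (eta : R) : D° w -> 0 < eta ->
  exists2 e : R, 0 < e & forall a, 0 <= a -> a <= e -> forall z, D z ->
    dot (grad Phi w - a *: y) (z - w) <= theta + eta.
Proof.
move=> Dw eta0; have [c c0 cP] := barrier_decay Dw.
pose K := m%:R * `|y| + 1.
have K0 : 0 < K by rewrite ltr_wpDl// mulr_ge0.
have u0 : 0 < Num.min 1 eta by rewrite lt_min ltr01.
exists (c * Num.min 1 eta / K); first by rewrite divr_gt0// mulr_gt0.
move=> a a0 ae z Dz.
pose l := a * K / c.
have l0 : 0 <= l by rewrite divr_ge0 ?(ltW c0)// mulr_ge0// ltW.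
have : l <= Num.min 1 eta.
  by rewrite /l ler_pdivrMr// -ler_pdivlMr// [_ * c]mulrC.
rewrite le_min => /andP[l1 leta].
have lc : l * c = a * K by rewrite /l divfK// gt_eqF.
have yz : - (a * dot y (z - w)) <= a * (K * `|z - w|).
  rewrite -mulrN; apply: ler_wpM2l => //.
  apply: (le_trans (ler_norm _)); rewrite normrN; apply: (le_trans (norm_dot _ _)).
  by rewrite mulrA ler_wpM2r// lerDl.
rewrite dotBl dotZl.
have h1 := barrier_bound Dw Dz; have h2 := cP z Dz.
move: h1 h2 yz; rewrite mulrA -lc.
move: (dot (grad Phi w) (z - w)) (dot y (z - w)) (`|z - w|) => g b n h1 h2 yz.
have e1 : (1 - l) * g <= (1 - l) * theta by rewrite ler_wpM2l// subr_ge0.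
have e2 : l * g <= l * (theta + 1 - c * n) by rewrite ler_wpM2l.
by move: e1 e2 yz leta; set ab := a * b; lra.
Qed.

End barrier_theory.

(** * Closedness and convexity of the range of a matrix *)

Lemma mulmx_kernel_closed {R : realType} p q (M : 'M[R]_(p, q)) :
  closed [set z : 'cV[R]_q | M *m z = 0].
Proof.
move=> z clz; apply/eqP; rewrite -normr_eq0 eq_le normr_ge0 andbT.
apply/ler_addgt0Pr => e e0; rewrite add0r.
pose C := q%:R * `|M| + 1.
have C0 : 0 < C by rewrite ltr_wpDl// mulr_ge0.
have [w [/= Mw]] := clz _ (nbhsx_ballx z _ (divr_gt0 e0 C0)).
rewrite -ball_normE /= => zw.
have -> : M *m z = M *m (z - w) by rewrite mulmxBr Mw subr0.
apply: (le_trans (norm_mulmx _ _)).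
apply: (@le_trans _ _ (C * `|z - w|)).
  by rewrite mulrA ler_wpM2r// lerDl.
by rewrite mulrC -ler_pdivlMr// ltW.
Qed.

(** The range is the kernel of the transposed cokernel matrix of [A^T]. *)
Lemma range_closed {R : realType} m n (A : 'M[R]_(m, n)) :
  closed (range (fun x : 'cV[R]_n => A *m x)).
Proof.
suff -> : range (fun x : 'cV[R]_n => A *m x) =
    [set z | (cokermx A^T)^T *m z = 0] by exact: mulmx_kernel_closed.
apply/seteqP; split => [_ [x _ <-]|z /= Mz].
  by rewrite /= mulmxA -{2}[A]trmxK -trmx_mul mulmx_coker trmx0 mul0mx.
have : (z^T <= A^T)%MS.
  by rewrite submxE -[cokermx _]trmxK -trmx_mul Mz trmx0.
move=> /submxP[x zx]; exists x^T => //.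
by rewrite -[LHS]trmxK trmx_mul trmxK -zx trmxK.
Qed.

Lemma range_segment {R : realType} m n (A : 'M[R]_(m, n)) :
  segment_closed (range (fun x : 'cV[R]_n => A *m x)).
Proof.
move=> _ _ t [x _ <-] [y _ <-] _; exists (x + t *: (y - x)) => //.
by rewrite mulmxDr -scalemxAr mulmxBr.
Qed.

(** * The domain-driven problem *)

Section domain_driven.
Context {R : realType} {n m : nat} (P : dd_problem R n m).
Hypothesis SP : dd_setting P.
Notation A := (ddA P).
Notation c := (ddc P).
Notation D := (ddD P).
Notation Phi := (ddPhi P).
Notation th := (theta P).
Implicit Types (x : 'cV[R]_n) (y z : 'cV[R]_m) (p : dd_point R n m).

Let D_closed := dd_closed SP.
Let D_segment := convex_set_segment (dd_convex SP).
Let theta_ge1 := dd_theta SP.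
Let barrier := dd_barrier SP.
Let th0 : 0 < th := lt_le_trans ltr01 theta_ge1.

Let sqrt_theta_le : Num.sqrt th <= th.
Proof.
rewrite -{2}(sqr_sqrtr (ltW th0)) expr2 ler_peMr ?sqrtr_ge0//.
by rewrite -{1}sqrtr1 ler_wsqrtr.
Qed.

Lemma support_le y (k : R) : (forall z, D z -> dot y z <= k) ->
  (support_function D y <= k%:E)%E.
Proof. by move=> yk; apply: ub_ereal_sup => _ [z Dz <-]; rewrite lee_fin yk. Qed.

Lemma le_support y (k : R) z : (support_function D y <= k%:E)%E -> D z ->
  dot y z <= k.
Proof.
move=> yk Dz; rewrite -lee_fin; apply: le_trans yk.
by apply: ereal_sup_ubound; exists z.
Qed.

Variables (xi kappa : R).
Hypothesis (xi_gt1 : 1 < xi) (kappa_gt0 : 0 < kappa).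
Hypothesis (xi_kappa : 0 < xi - 1 - kappa).

Lemma close_point_bound p z : Q_DD P p -> 0 < mu P xi p ->
  close_to_central_path P xi kappa p -> D z ->
  dot (py p) (z - shifted P p) <=
    mu P xi p / ptau p * (th + kappa * Num.sqrt th).
Proof.
move=> [_ tau0 _ Dy] mu0 close Dz.
have k0 : 0 < ptau p / mu P xi p by exact: divr_gt0.
have Ds := rec_polar_interiorZ k0 Dy.
have [w [Dw gw gs hs]] :=
  conjugate_duality D_closed D_segment theta_ge1 barrier
    (ex_intro _ _ Dy) (dd_interior SP) Ds.
move: close; rewrite /close_to_central_path /= gs hs /mxnorm.
set s := (ptau p / mu P xi p) *: py p in Ds gw gs hs *.
set d := shifted P p - w => close.
have b1 := barrier_bound D_segment theta_ge1 barrier Dw Dz.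
have b2 := barrier_grad_bound theta_ge1 barrier d Dw.
rewrite gw in b1 b2.
have b3 : dot s (z - shifted P p) <= th + kappa * Num.sqrt th.
  have -> : z - shifted P p = (z - w) - d.
    by apply/colP => i; rewrite !mxE; ring.
  rewrite dotBr; apply: lerD => //; apply: le_trans (ler_norm _) _.
  rewrite normrN; apply: (le_trans b2); rewrite mulrC.
  by apply: ler_wpM2r; [exact: sqrtr_ge0|exact: close].
move: b3; rewrite dotZl.
by rewrite mulrC -ler_pdivlMr// invf_div mulrC.
Qed.

Lemma mu_eq p : 0 < ptau p -> mu P xi p / ptau p * (xi * th) =
  - ytau0 P xi - ptau p * dot c (px p) - dot (py p) (shifted P p).
Proof.
move=> tau0; rewrite /mu; set b := _ - dot (py p) _.
have t' : ptau p != 0 by rewrite gt_eqF.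
have h' : th != 0 by rewrite gt_eqF.
have x' : xi != 0 by rewrite gt_eqF// (lt_trans ltr01).
by field; rewrite t' h' x'.
Qed.

(** [close_point_bound] is tested at [A xb], and the support bound for [yb] at the shifted point,
    multiplied by [tau]. The equations for [A^T] replace every occurrence of [c] by a product with
    [yb], and the rest is linear. *)
Lemma gap_pair_bound p xb yb (eta : R) : Q_DD P p -> 0 < mu P xi p ->
  close_to_central_path P xi kappa p ->
  primal_feasible P xb -> A^T *m yb = - c ->
  (support_function D yb <= (eta - dot c xb)%:E)%E ->
  mu P xi p / ptau p * ((xi - 1) * th - kappa * Num.sqrt th) <=
    xi * th + dot (y0 P - yb) (z0 P - A *m xb) + ptau p * eta.
Proof.
move=> Qp mu0 close Dxb Ayb sup_yb.
have h1 := close_point_bound Qp mu0 close Dxb.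
have [Du tau0 Ay _] := Qp.
have h2 := le_support sup_yb (interior_subset Du).
have h3 := mu_eq tau0.
have cx : dot c (px p) = - dot yb (A *m px p).
  by rewrite dot_mulmxl Ayb dotNl opprK.
have cxb : dot c xb = - dot yb (A *m xb).
  by rewrite dot_mulmxl Ayb dotNl opprK.
have yxb : dot (py p) (A *m xb) =
    dot (y0 P) (A *m xb) + (ptau p - 1) * dot yb (A *m xb).
  have -> : dot (py p) (A *m xb) = dot (A^T *m py p - A^T *m y0 P) xb +
      dot (y0 P) (A *m xb) by rewrite dotBl -!dot_mulmxl subrK.
  by rewrite Ay dotNl dotZl cxb mulrN opprK addrC.
have tu : ptau p * dot yb (shifted P p) = ptau p * dot yb (A *m px p) + dot yb (z0 P).
  by rewrite /shifted dotDr dotZr mulrDr mulrA mulfV ?mul1r// gt_eqF.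
move: h1 h2 h3; rewrite dotBr yxb cx cxb /ytau0 => h1 h2 h3.
have h2' := ler_wpM2l (ltW tau0) h2.
move: h2'; rewrite tu dotBl !dotBr => h2'.
move: h1 h3 h2'; set q := mu P xi p / ptau p.
move: (dot (py p) (shifted P p)) (dot yb (A *m xb)) (dot yb (A *m px p)).
move: (dot (y0 P) (A *m xb)) (dot (y0 P) (z0 P)) (dot yb (z0 P)) (ptau p).
move=> a b c' t u v w h1 h3 h2'.
lra.
Qed.

(** * Central points and the feasibility measure *)

Lemma range_min s x1 : (rec_polar D)° s -> D° (A *m x1) ->
  exists2 x, D° (A *m x) &
    forall x', D° (A *m x') -> tilted Phi s (A *m x) <= tilted Phi s (A *m x').
Proof.
move=> Ds Dx1.
have Lx1 : range (fun x : 'cV[R]_n => A *m x) (A *m x1) by exists x1.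
have [w [Dw [x _ xw]] wmin] := barrier_min D_closed D_segment theta_ge1 barrier
  (@range_closed R m n A) (@range_segment R m n A) Ds Dx1 Lx1.
exists x; first by rewrite xw.
by move=> x' Dx'; rewrite xw; apply: wmin Dx' _; exists x'.
Qed.

Lemma range_stationary s x : D° (A *m x) ->
  (forall x', D° (A *m x') -> tilted Phi s (A *m x) <= tilted Phi s (A *m x')) ->
  A^T *m grad Phi (A *m x) = A^T *m s.
Proof.
move=> Dx xmin; apply: dot_inj => d; rewrite -!dot_mulmxl.
apply: (tilted_stationary barrier Dx) => t.
by rewrite scalemxAr -mulmxDr; exact: xmin.
Qed.

(** The minimizer of [Phi (A x) + t <c, x>], with dual point [Phi' (A x) / t], has duality gap at
    most [theta / t], which is [eta]. *)
Lemma approximate_pair (eta : R) : strictly_feasible P -> 0 < eta ->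
  exists xb yb, [/\ primal_feasible P xb, A^T *m yb = - c &
    (support_function D yb <= (eta - dot c xb)%:E)%E].
Proof.
move=> [[x1 Dx1] [y1 [Dy1 Ay1]]] eta0.
pose t := th / eta; have t0 : 0 < t by exact: divr_gt0.
have [x Dx xmin] := range_min (rec_polar_interiorZ t0 Dy1) Dx1.
have stat := range_stationary Dx xmin.
pose yb := t^-1 *: grad Phi (A *m x).
have Ayb : A^T *m yb = - c.
  by rewrite -scalemxAr stat -scalemxAr Ay1 scalerA mulVf ?scale1r// gt_eqF.
exists x, yb; split; [exact: (interior_subset Dx)|exact: Ayb|].
apply: support_le => z Dz.
have -> : dot c x = - dot yb (A *m x) by rewrite dot_mulmxl Ayb dotNl opprK.
rewrite opprK -lerBlDr -dotBr dotZl mulrC ler_pdivrMr//.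
rewrite /t mulrCA mulfV ?gt_eqF// mulr1.
exact: (barrier_bound D_segment theta_ge1 barrier Dx Dz).
Qed.

(** Strict dual feasibility rewrites [<c, x>] as [- <y1, A x>]; the objective is then a tilted
    barrier, whose minimum exists, so [get] returns a true minimizer. *)
Lemma xbar1P : strictly_feasible P ->
  D° (A *m xbar1 P) /\ A^T *m ybar1 P = - c.
Proof.
move=> [[x1 Dx1] [y1 [Dy1 Ay1]]].
have tiltE x : tilted Phi y1 (A *m x) = Phi (A *m x) + dot c x.
  by rewrite /tilted dot_mulmxl Ay1 dotNl opprK.
have [x Dx xmin] := range_min Dy1 Dx1.
have [Dxb xbmin] : [set x | D° (A *m x) /\ forall x', D° (A *m x') ->
    Phi (A *m x) + dot c x <= Phi (A *m x') + dot c x'] (xbar1 P).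
  by apply: getPex; exists x; split => // x'; rewrite -!tiltE; exact: xmin.
split => //; rewrite -Ay1; apply: range_stationary => // x' Dx'.
by rewrite !tiltE; exact: xbmin.
Qed.

(* [sigma_f P xi] is [sup sigma_set]. *)
Definition sigma_set := [set alpha : R |
    [/\ alpha < 1,
        rec_polar D (ybar1 P - alpha *: y0 P),
        D ((1 - alpha)^-1 *: (A *m xbar1 P - alpha *: z0 P))
      & (support_function D (ybar1 P - alpha *: y0 P)
         + (ytaubar1 P xi)%:E - (alpha * ytau0 P xi)%:E <= 0)%E]].

Lemma sigma_set_support alpha :
  (support_function D (ybar1 P - alpha *: y0 P)
         + (ytaubar1 P xi)%:E - (alpha * ytau0 P xi)%:E <= 0)%E <->
  (support_function D (ybar1 P - alpha *: y0 P) <=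
    (alpha * ytau0 P xi - ytaubar1 P xi)%:E)%E.
Proof.
case: (support_function _ _) => [r| |] /=.
- by rewrite -!EFinD !lee_fin lerBrDr -[X in X <= 0]/(_ - _) subr_le0.
- by rewrite !leye_eq.
- by rewrite !leNye.
Qed.

Let denominator_ge : (xi - 1 - kappa) * th <= (xi - 1) * th - kappa * Num.sqrt th.
Proof.
have := ler_wpM2l (ltW kappa_gt0) sqrt_theta_le.
by move=> h; rewrite [X in X <= _]mulrBl lerD2l lerN2.
Qed.

Lemma sigma_set_bound alpha p : strictly_feasible P -> sigma_set alpha ->
  0 < alpha -> Q_DD P p -> 0 < mu P xi p ->
  close_to_central_path P xi kappa p ->
  alpha * mu P xi p <= xi / (xi - 1 - kappa) * ptau p.
Proof.
move=> SF [a1 _ Dq /sigma_set_support sup_p] a0 Qp mu0 close.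
have [_ tau0 _ _] := Qp.
have [Dzb Ayb1] := xbar1P SF.
set zb := A *m xbar1 P in Dzb Dq *.
(* Pairs of arbitrarily small gap are at hand, so the estimate is first shown up to [e]. *)
suff main : forall e : R, 0 < e ->
    mu P xi p / ptau p * ((xi - 1) * th - kappa * Num.sqrt th) <=
    xi * th / alpha + e.
  have {main} : mu P xi p / ptau p * ((xi - 1 - kappa) * th) <= xi * th / alpha.
    apply/ler_addgt0Pr => e e0; apply: le_trans (main e e0).
    by apply: ler_wpM2l => //; rewrite divr_ge0// ltW.
  rewrite ler_pdivlMr//; set q := mu P xi p / ptau p => h.
  have -> : mu P xi p = q * ptau p by rewrite divfK// gt_eqF.
  rewrite mulrA; apply: ler_wpM2r (ltW tau0) _ _ _.
  rewrite ler_pdivlMr// -(ler_pM2r th0).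
  by apply: le_trans h; rewrite le_eqVlt; apply/orP; left; apply/eqP; ring.
move=> e e0.
(* The gap [eta] enters once with factor [(1 - alpha) / alpha] and once with factor [tau];
   [eta = e / k] makes the total [e]. *)
pose k := (1 - alpha) / alpha + ptau p.
have k0 : 0 < k by rewrite ltr_wpDl// divr_ge0 ?(ltW a0)// subr_ge0 ltW.
pose eta := e / k; have eta0 : 0 < eta by exact: divr_gt0.
have [xb [yb [Dxb Ayb sup_yb]]] := approximate_pair SF eta0.
apply: (le_trans (gap_pair_bound Qp mu0 close Dxb Ayb sup_yb)).
have hp := le_support sup_p Dxb.
have hq := le_support sup_yb Dq.
have orth : dot (ybar1 P - yb) (zb - A *m xb) = 0.
  by rewrite -mulmxBr dot_mulmxl mulmxBr Ayb1 Ayb subrr dot0l.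
have cxb : dot c xb = - dot yb (A *m xb).
  by rewrite dot_mulmxl Ayb dotNl opprK.
have a1' : 0 < 1 - alpha by rewrite subr_gt0.
have {}hq : dot yb (zb - alpha *: z0 P) <= (1 - alpha) * (eta + dot yb (A *m xb)).
  by move: hq; rewrite cxb opprK dotZr mulrC ler_pdivrMr// mulrC.
move: hp hq orth; rewrite /ytaubar1 /ytau0 -/zb.
rewrite !dotBl !dotBr !dotZr !dotZl => hp hq orth.
have ke : (1 - alpha) * eta + alpha * ptau p * eta = alpha * e.
  by rewrite /eta /k; field; rewrite ?gt_eqF//= addr_gt0// mulr_gt0.
rewrite -(ler_pM2l a0) [leRHS]mulrDr [alpha * (_ / _)]mulrC divfK ?gt_eqF//.
rewrite -ke.
move: hp hq orth.
move: (dot (ybar1 P) (A *m xb)) (dot (ybar1 P) zb) (dot yb zb) (dot yb (A *m xb)).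
move: (dot (y0 P) (A *m xb)) (dot (y0 P) (z0 P)) (dot yb (z0 P)).
move=> a b a' d u v w hp hq orth.
lra.
Qed.

(** At [alpha = 0] the primal point is interior and the support inequality has slack
    [(xi - 1) theta], so every small [alpha] is admissible. *)
Lemma sigma_set_gt0 : strictly_feasible P -> exists2 alpha, 0 < alpha &
  sigma_set alpha.
Proof.
move=> SF; have [Dzb _] := xbar1P SF.
have [_ [y1 [Dy1 _]]] := SF.
set zb := A *m xbar1 P in Dzb.
(* Half of the slack pays for perturbing the support function, half for the terms linear in
   [alpha]. *)
pose eta := (xi - 1) * th / 2.
have eta0 : 0 < eta by rewrite divr_gt0// mulr_gt0// subr_gt0.
have [e e0 eP] := barrier_support_perturb D_closed D_segment theta_ge1 barrier
  (ex_intro _ _ Dy1) (y0 P) Dzb eta0.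
have [r r0 rP] := interior_ball Dzb.
pose M := `|dot (y0 P) (z0 P - zb) + xi * th| + 1.
have M0 : 0 < M by rewrite ltr_wpDl.
(* The four bounds control, in turn, the support function, the factor [1 / (1 - a)], the distance to
   [zb], and the terms linear in [a]. *)
pose a := Num.min (Num.min e (1 / 2))
  (Num.min (r / (2 * (`|zb - z0 P| + 1))) (eta / M)).
have b0 : 0 < 2 * (`|zb - z0 P| + 1) by rewrite mulr_gt0// ltr_wpDl.
have h0 : 0 < 1 / 2 :> R by rewrite divr_gt0.
have a0 : 0 < a.
  by rewrite /a !lt_min e0 h0 (divr_gt0 r0 b0) (divr_gt0 eta0 M0).
have : a <= a by [].
rewrite {2}/a !le_min => /andP[/andP[ae ah] /andP[ar aM]].
have a1 : a < 1 by apply: le_lt_trans ah _; rewrite ltr_pdivrMr// mul1r ltr1n.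
have sup_a : forall z, D z ->
    dot (ybar1 P - a *: y0 P) z <= a * ytau0 P xi - ytaubar1 P xi.
  move=> z Dz; have h1 : dot (ybar1 P - a *: y0 P) (z - zb) <= th + eta.
    exact: eP (ltW a0) ae z Dz.
  have h2 : a * (dot (y0 P) (z0 P - zb) + xi * th) <= eta.
    apply: (@le_trans _ _ (a * M)); last by rewrite -ler_pdivlMr.
    apply: ler_wpM2l; first exact: ltW.
    by rewrite (le_trans (ler_norm _))// lerDl.
  move: h1 h2; rewrite /ytau0 /ytaubar1 -/zb /eta !dotBl !dotBr !dotZl.
  move: (dot (ybar1 P) z) (dot (ybar1 P) zb) (dot (y0 P) z) (dot (y0 P) zb).
  by move: (dot (y0 P) (z0 P)) => u v w x y h1 h2; lra.
exists a => //; split => //.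
- apply: support_function_rec_polar (support_le sup_a).
  by have [z Dz] := dd_interior SP; exists z; exact: interior_subset.
- apply: interior_subset; apply: rP.
  have a1' : 0 < 1 - a by rewrite subr_gt0.
  have -> : zb - (1 - a)^-1 *: (zb - a *: z0 P) = (- (a / (1 - a))) *: (zb - z0 P).
    by apply/colP => i; rewrite !mxE; field; rewrite gt_eqF.
  rewrite normrZ normrN gtr0_norm ?divr_gt0//.
  rewrite mulrAC ltr_pdivrMr//.
  have : a * (2 * (`|zb - z0 P| + 1)) <= r by rewrite -ler_pdivlMr.
  have := normr_ge0 (zb - z0 P); move: (`|zb - z0 P|) => q q0 h.
  by nra.
- by apply/sigma_set_support; exact: support_le sup_a.
Qed.

Lemma sigma_f_bounds : strictly_feasible P -> 0 < sigma_f P xi <= 1.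
Proof.
move=> SF; have [a a0 Sa] := sigma_set_gt0 SF.
have ub1 : ubound sigma_set 1 by move=> b [/ltW].
apply/andP; split; last by apply: ge_sup => //; exists a.
apply: (lt_le_trans a0); apply: ub_le_sup => //.
by exists 1.
Qed.

Lemma sigma_f_bound p : strictly_feasible P -> Q_DD P p -> 0 < mu P xi p ->
  close_to_central_path P xi kappa p ->
  sigma_f P xi * mu P xi p <= xi / (xi - 1 - kappa) * ptau p.
Proof.
move=> SF Qp mu0 close; have [a a0 Sa] := sigma_set_gt0 SF.
have [_ tau0 _ _] := Qp.
rewrite -ler_pdivlMr//; apply: ge_sup; first by exists a.
move=> b Sb; rewrite ler_pdivlMr//.
have [b0|b0] := ltP 0 b; first exact: sigma_set_bound.
apply: (@le_trans _ _ 0); first by rewrite pmulr_lle0.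
by rewrite mulr_ge0 ?(ltW tau0)// divr_ge0 ?(ltW xi_kappa)// ltW// (lt_trans ltr01).
Qed.

(** * Zero duality gap and the factor B *)

Let pair_set :=
  [set dot (y0 P - q.2) (z0 P - A *m q.1) | q in zero_gap_pairs P].

Lemma duality_gap0 x y : duality_gap P x y = 0%E ->
  support_function D y = (- dot c x)%:E.
Proof.
rewrite /duality_gap; case: support_function => [r| |] //=.
by rewrite -EFinD => -[] /eqP; rewrite addrC addr_eq0 => /eqP ->.
Qed.

(** [barrier_bound] at [z0] controls the product with [y0], and zero gap means that [dot y] attains
    its maximum over [D] at [A x]. *)
Lemma pair_set_lbound : lbound pair_set (- th).
Proof.
move=> _ [[x y] [/= Dx [_ Ay] /duality_gap0 gap] <-] /=.
have h1 := barrier_bound D_segment theta_ge1 barrier (dd_z0 SP) Dx.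
have cx : dot c x = - dot y (A *m x) by rewrite dot_mulmxl Ay dotNl opprK.
have h2 : dot y (z0 P) <= dot y (A *m x).
  apply: le_support (interior_subset (dd_z0 SP)).
  by rewrite gap cx opprK.
move: h1; rewrite -/(y0 P) dotBl !dotBr.
move: h2; move: (dot y _) (dot y _) (dot (y0 P) _) (dot (y0 P) _) => a b u v; lra.
Qed.

Lemma denominator_gt0 : 0 < (xi - 1) * th - kappa * Num.sqrt th.
Proof. by apply: lt_le_trans denominator_ge; exact: mulr_gt0. Qed.

(** By the lower bound [- theta] the numerator is at least [(xi - 1) theta], which is at least the
    denominator. *)
Lemma B_factor_ge1 : zero_gap_pairs P !=set0 -> 1 <= B_factor P xi kappa.
Proof.
move=> [q Zq]; rewrite /B_factor ler_pdivlMr ?denominator_gt0// mul1r.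
have : - th <= inf pair_set.
  by apply: lb_le_inf pair_set_lbound; exists (dot (y0 P - q.2) (z0 P - A *m q.1)), q.
have := mulr_ge0 (ltW kappa_gt0) (sqrtr_ge0 th).
by rewrite /pair_set; move: (inf _) (kappa * _) => a b; lra.
Qed.

Lemma B_factor_bound p : zero_gap_pairs P !=set0 -> Q_DD P p ->
  0 < mu P xi p -> close_to_central_path P xi kappa p ->
  (B_factor P xi kappa)^-1 * mu P xi p <= ptau p.
Proof.
move=> ZP Qp mu0 close; have B1 := B_factor_ge1 ZP.
have B0 : 0 < B_factor P xi kappa by exact: lt_le_trans B1.
have [_ tau0 _ _] := Qp.
rewrite mulrC ler_pdivrMr// mulrC -ler_pdivrMr//.
rewrite /B_factor ler_pdivlMr ?denominator_gt0// [leRHS]addrC -lerBlDr.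
have [q0 Zq0] := ZP.
apply: lb_le_inf; first by exists (dot (y0 P - q0.2) (z0 P - A *m q0.1)), q0.
move=> _ [[x y] [/= Dx [_ Ay] /duality_gap0 gap] <-].
rewrite lerBlDr [leRHS]addrC -[leRHS]addr0 -(mulr0 (ptau p)).
apply: gap_pair_bound => //.
by rewrite gap sub0r.
Qed.

End domain_driven.

(** * From the growth of [mu] to the iteration count *)

Lemma sqrtr_ge1 {R : realType} (t : R) : 1 <= t -> 1 <= Num.sqrt t.
Proof. by move=> t1; rewrite -{1}sqrtr1 ler_wsqrtr. Qed.

(* Used with sigma = sigma_f in part (a) and with sigma = 1 / B, K = 1 in part
   (b); N is chosen so that mu >= K^2 (theta / (sigma eps))^2. *)
Lemma run_eps_solution {R : realType} n m (P : dd_problem R n m)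
    (xi kappa g K sigma eps : R) (pt : nat -> dd_point R n m) :
  1 <= theta P -> 0 < g -> 1 <= K -> 0 < sigma <= 1 -> 0 < eps <= 1 / 2 ->
  PtPCA_run P xi kappa g pt ->
  (forall N, sigma * mu P xi (pt N) <= K * ptau (pt N)) ->
  exists N : nat, N%:R <= ((2 * ln K / ln 2 + 2) / g + 1 / ln 2) *
      (Num.sqrt (theta P) * ln (theta P / (sigma * eps))) /\
    eps_solution P xi eps (pt N).
Proof.
move=> th1 g0 K1 /andP[s0 s1] /andP[e0 e1] run tau_ge.
set th := theta P in th1 *.
have th0 : 0 < th by exact: lt_le_trans th1.
have K0 : 0 < K by exact: lt_le_trans K1.
have se : 0 < sigma * eps by exact: mulr_gt0.
pose Y := th / (sigma * eps).
have Y2 : 2 <= Y.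
  by rewrite ler_pdivlMr//; nra.
have Y0 : 0 < Y by exact: lt_le_trans Y2.
have l2 : 0 < ln 2 :> R by rewrite ln_gt0// ltr1n.
have lY : ln 2 <= ln Y by rewrite ler_ln ?posrE.
have lK : 0 <= ln K by rewrite ln_ge0.
have q1 := sqrtr_ge1 th1; set q := Num.sqrt th in q1 *.
have q0 : 0 < q by exact: lt_le_trans q1.
(* Chosen so that [expR X] is [K^2 Y^2]; rounding up [X q / g] to [N] ensures [mu >= expR X]. *)
pose X := 2 * ln K + 2 * ln Y.
have X0 : 0 <= X by rewrite /X addr_ge0// mulr_ge0// (le_trans (ltW l2)).
pose N := (Num.truncn (q / g * X)).+1.
have qgX : 0 <= q / g * X by rewrite mulr_ge0// divr_ge0 ?ltW.
have /andP[N1 /ltW N2] := truncn_itv qgX.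
have {}N1 : N%:R <= q / g * X + 1 by rewrite /N -natr1 lerD2r.
exists N; split.
  apply: (le_trans N1); rewrite -/q -/Y.
  (* Since [Y >= 2], the constant [ln K] and the 1 from rounding are absorbed into multiples of
     [ln Y]. *)
  have h1 : ln K <= ln K / ln 2 * ln Y.
    by rewrite mulrAC ler_pdivlMr// ler_wpM2l.
  have h2 : 1 <= 1 / ln 2 * (q * ln Y).
    rewrite mulrAC mul1r ler_pdivlMr// mul1r (le_trans lY)//.
    by rewrite ler_peMl// (le_trans (ltW l2)).
  rewrite mulrDl; apply: lerD h2.
  rewrite (_ : _ * (q * ln Y) = q / g * ((2 * ln K / ln 2 + 2) * ln Y)); last by ring.
  apply: ler_wpM2l; first by rewrite divr_ge0 ?ltW.
  by rewrite /X; lra.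
have [QN mu0 _ mu_ge] := run N.
split => //; have [_ tau0 _ _] := QN.
have muX : expR X <= mu P xi (pt N).
  apply: le_trans mu_ge; rewrite ler_expR -/q.
  by rewrite ler_pdivlMr// mulrC [g * _]mulrC -ler_pdivrMr// mulrAC.
have eX : expR X = K ^+ 2 * Y ^+ 2.
  by rewrite /X expRD !expRM_natl !lnK ?posrE.
rewrite eX in muX.
set u := mu P xi (pt N) in mu0 muX tau_ge *; set t := ptau (pt N) in tau0 *.
have tu : sigma * u <= K * t by exact: tau_ge.
have sY : sigma * Y * eps = th by rewrite /Y; field; rewrite ?gt_eqF.
have sY1 : 1 <= sigma * Y.
  rewrite -(ler_pM2r e0) sY mul1r (le_trans _ th1)// (le_trans e1)//.
  by rewrite ler_pdivrMr// mul1r ler1n.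
have sKY : sigma * K * Y ^+ 2 <= t.
  rewrite -(ler_pM2l K0); apply: le_trans tu.
  rewrite (_ : K * _ = sigma * (K ^+ 2 * Y ^+ 2)); last by ring.
  by rewrite ler_pM2l.
rewrite ge_max; apply/andP; split.
  rewrite -[leLHS]mul1r ler_pdivrMr//.
  apply: (le_trans th1); rewrite -sY mulrC ler_pM2l//; apply: le_trans sKY.
  rewrite (_ : sigma * K * Y ^+ 2 = sigma * Y * (K * Y)); last by ring.
  rewrite ler_peMr//; first by rewrite (le_trans ler01).
  by rewrite mulr_ege1// (le_trans _ Y2)// ler1n.
rewrite ler_pdivrMr ?exprn_gt0//.
(* One factor [mu] of [(sigma mu)^2] is bounded below by [K^2 Y^2], the other is kept to cancel the
   [mu] of the accuracy criterion. *)
have t2 : sigma ^+ 2 * Y ^+ 2 * u <= t ^+ 2.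
  rewrite -(ler_pM2l (exprn_gt0 2 K0)).
  have h : (sigma * u) ^+ 2 <= (K * t) ^+ 2.
    by rewrite ler_pXn2r ?nnegrE// mulr_ge0// ltW.
  rewrite -[leRHS]exprMn; apply: le_trans h.
  rewrite (_ : K ^+ 2 * _ = sigma ^+ 2 * u * (K ^+ 2 * Y ^+ 2)); last by ring.
  rewrite (_ : (sigma * u) ^+ 2 = sigma ^+ 2 * u * u); last by ring.
  by rewrite ler_pM2l// mulr_gt0// exprn_gt0.
apply: (@le_trans _ _ (eps * (sigma ^+ 2 * Y ^+ 2 * u))); last by rewrite ler_pM2l.
rewrite (_ : eps * _ = (sigma * Y) * (sigma * Y * eps) * u); last by ring.
by rewrite sY ler_pM2r// ler_peMl// ltW.
Qed.

Theorem theorem5p2 (R : realType)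
    (gamma : R -> R) (gamma_gt0 : forall xi : R, 1 < xi -> 0 < gamma xi)
    (xi kappa : R) (xi_gt1 : 1 < xi) (kappa_gt0 : 0 < kappa)
    (xi_kappa : 0 < xi - 1 - kappa) :
  (exists C : R, 0 < C /\
    forall (n m : nat) (P : dd_problem R n m) (pt : nat -> dd_point R n m),
      dd_setting P -> PtPCA_run P xi kappa (gamma xi) pt ->
      strictly_feasible P ->
      forall eps : R, 0 < eps -> eps <= 1 / 2 ->
      exists N : nat,
        N%:R <= C * (Num.sqrt (theta P)
                     * ln (theta P / (sigma_f P xi * eps))) /\
        eps_solution P xi eps (pt N)) /\
  (exists C : R, 0 < C /\
    forall (n m : nat) (P : dd_problem R n m) (pt : nat -> dd_point R n m),
      dd_setting P -> PtPCA_run P xi kappa (gamma xi) pt ->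
      zero_gap_pairs P !=set0 ->
      forall eps : R, 0 < eps -> eps <= 1 / 2 ->
      exists N : nat,
        N%:R <= C * (Num.sqrt (theta P)
                     * ln (theta P * B_factor P xi kappa / eps)) /\
        eps_solution P xi eps (pt N)).
Proof.
have g0 := gamma_gt0 xi xi_gt1.
have l2 : 0 < ln 2 :> R by rewrite ln_gt0// ltr1n.
have C_gt0 (K : R) : 1 <= K -> 0 < (2 * ln K / ln 2 + 2) / gamma xi + 1 / ln 2.
  move=> K1; rewrite addr_gt0 ?divr_gt0// ltr_wpDl//.
  by rewrite divr_ge0 ?(ltW l2)// mulr_ge0// ln_ge0.
split.
  (* The constant of [sigma_f_bound] depends on [xi] and [kappa] only, and the iteration constant is
     fixed before the problem is given. *)
  pose K := xi / (xi - 1 - kappa).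
  have K1 : 1 <= K by rewrite ler_pdivlMr// mul1r; lra.
  exists ((2 * ln K / ln 2 + 2) / gamma xi + 1 / ln 2); split; first exact: C_gt0.
  move=> n m P pt SP run SF eps e0 e1.
  apply: (run_eps_solution (dd_theta SP) g0 K1 (sigma_f_bounds SP xi_gt1 SF) _ run).
    by rewrite e0 e1.
  move=> N; have [QN mu0 close _] := run N.
  exact: (sigma_f_bound SP xi_gt1 kappa_gt0 xi_kappa SF QN mu0 close).
exists ((2 * ln 1 / ln 2 + 2) / gamma xi + 1 / ln 2); split; first exact: C_gt0.
move=> n m P pt SP run ZP eps e0 e1.
have B1 := B_factor_ge1 SP kappa_gt0 xi_kappa ZP.
have B0 : 0 < B_factor P xi kappa by exact: lt_le_trans B1.
(* Puts the logarithm into the form of [run_eps_solution] with [sigma = 1 / B]. *)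
have -> : theta P * B_factor P xi kappa / eps =
    theta P / ((B_factor P xi kappa)^-1 * eps).
  by move: (B_factor P xi kappa) => b; rewrite invfM invrK mulrA.
apply: (run_eps_solution (dd_theta SP) g0 (lexx 1) _ _ run).
- by rewrite invr_gt0 B0 invf_le1.
- by rewrite e0 e1.
- move=> N; have [QN mu0 close _] := run N; rewrite [leRHS]mul1r.
  exact: (B_factor_bound SP xi_gt1 kappa_gt0 xi_kappa ZP QN mu0 close).
Qed.
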